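(* Let $n$ be a positive integer, let $0<\alpha\leq 1$, and let $C\geq 0$ be a real constant. Suppose that the functions $D,E:\mathbb{D}\to\mathbb{C}$ satisfy $$|\operatorname{Im} E(z)|< n\alpha\,(\operatorname{Re} D(z)-C)\qquad (z\in\mathbb{D}).$$ If $h\in\mathcal{A}_n$ satisfies, for $z\in\mathbb{D}$, $$C\left(2\left(\frac{zh'(z)}{h(z)}\right)^{3}-\frac{3z^{3}h'(z)h''(z)}{h^{2}(z)}+\frac{z^{3}h'''(z)}{h(z)}\right)+(2C+D(z))\left(\frac{z^{2}h''(z)}{h(z)}-\left(\frac{zh'(z)}{h(z)}\right)^{2}\right)+(D(z)+E(z))\frac{zh'(z)}{h(z)}=0,$$ then $h\in\mathcal{S}^*[\alpha]$.
   Context: $\mathbb{D}$ is the open unit disc in $\mathbb{C}$. $\mathcal{H}[1,n]$ is the class of analytic functions on $\mathbb{D}$ of the form $1+p_nz^n+p_{n+1}z^{n+1}+\cdots$; $\mathcal{A}_n=\{z\,g(z): g\in\mathcal{H}[1,n]\}$ and $\mathcal{A}=\mathcal{A}_1$. Quotients with a removable singularity at $z=0$ are interpreted by continuity there. For analytic functions $f,g$ on $\mathbb{D}$, $f\prec g$ ($f$ is subordinate to $g$) means there is an analytic $w:\mathbb{D}\to\mathbb{D}$ with $w(0)=0$ and $f(z)=g(w(z))$ for all $z\in\mathbb{D}$. For $0<\alpha\leq 1$, $\mathcal{S}^*[\alpha]=\left\{f\in\mathcal{A}: \frac{zf'(z)}{f(z)}\prec\left(\frac{1+z}{1-z}\right)^{\alpha}\right\}$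 is the class of strongly starlike functions of order $\alpha$, with the principal branch of the power. *)

(* Defs.v *)
From Stdlib Require Import Reals.
From Coquelicot Require Import Coquelicot.
Open Scope C_scope.

(* Functions on the open unit disc are total maps [C -> C] of which only the
   values on [unit_disc] matter; [ex_derive] and [C_derive] at a point of the disc
   are complex derivatives and are local, so junk values outside are harmless. *)
Definition unit_disc (z : C) : Prop := (Cmod z < 1)%R.

Definition analytic (f : C -> C) : Prop := forall z, unit_disc z -> ex_derive f z.

(* H[1,n]: analytic, with the form 1 + p_n z^n + p_(n+1) z^(n+1) + ... *)
Definition class_H1 (n : nat) (g : C -> C) : Prop :=
  analytic g /\
  exists p : nat -> C,
    p 0%nat = 1 /\
    (forall k : nat, (0 < k < n)%nat -> p k = 0) /\
    (forall z, unit_disc z -> is_pseries p z (g z)).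

Definition class_A (n : nat) (f : C -> C) : Prop :=
  exists g, class_H1 n g /\ forall z, unit_disc z -> f z = z * g z.

(* Value at [z] of a function with a removable singularity at 0, interpreted
   by continuity there.  [C_lim] is the punctured limit when it exists. *)
Definition cont0 (F : C -> C) (z : C) : C :=
  if Ceq_dec z 0 then C_lim F 0 else F z.

Definition subordinate (f g : C -> C) : Prop :=
  exists w : C -> C,
    analytic w /\
    (forall z, unit_disc z -> unit_disc (w z)) /\
    w 0 = 0 /\
    (forall z, unit_disc z -> f z = g (w z)).

(* Principal argument, in (-PI, PI] for [z <> 0]. *)
Definition Carg (z : C) : R :=
  if Rle_dec 0 (Im z) then acos (Re z / Cmod z) else (- acos (Re z / Cmod z))%R.

Definition Cln (z : C) : C := (ln (Cmod z), Carg z).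

Definition Cexp (z : C) : C :=
  ((exp (Re z) * cos (Im z))%R, (exp (Re z) * sin (Im z))%R).

(* Principal branch of [z ^ a], meaningful for [z <> 0] only. *)
Definition Cpower (z : C) (a : R) : C := Cexp (a * Cln z).

(* Division by 0 is total here, so a quotient by [f z] only has its intended
   meaning away from the zeros of [f]. *)
Definition zero_free_off_0 (f : C -> C) : Prop :=
  forall z, unit_disc z -> z <> 0 -> f z <> 0.

Definition strongly_starlike (alpha : R) (f : C -> C) : Prop :=
  class_A 1 f /\
  zero_free_off_0 f /\
  subordinate (cont0 (fun z => z * C_derive f z / f z))
              (fun z => Cpower ((1 + z) / (1 - z)) alpha).

(* Main.v *)
Require Import Defs.
From Stdlib Require Import Reals Lra Lia Psatz ClassicalEpsilon.
From Coquelicot Require Import Coquelicot.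
Open Scope C_scope.

(* With [p z = z h'(z) / h(z)] the hypothesis reads [C z^2 p'' + D z p' + E p = 0], and the
   claim is that [p] maps the disc into the sector [|arg w| < alpha pi / 2].  Otherwise let
   [z0] be a point of smallest modulus with [p z0] outside the sector; [p z0] lies on an edge
   of it.  Let [tau] rotate that edge onto the imaginary axis.  On the circle [|z| = |z0|] the
   function [Re (tau p)] is minimal at [z0], so [tau z0 p'(z0) = - sigma] is real and
   [Re (tau z0^2 p''(z0)) <= sigma].  On [|z| < |z0|] the map
   [w = (p^(1/alpha) - 1) / (p^(1/alpha) + 1)] satisfies [|w z| <= |z / z0|^n] by the Schwarz
   lemma, which bounds [arg p] along the radius through [z0] and gives
   [sigma >= n alpha |p z0|], and [sigma > 0] even if [p z0 = 0].  The real part of [tau] times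
   the equation at [z0] then contradicts [|Im E| < n alpha (Re D - C)]. *)

(** * Complex differentiation *)

(** Why [n * alpha]: [p - 1 = z g' / g] is [O(z^n)], so the disc-valued map [w] vanishes to order
    [n] at 0, and [|w (t z0)| <= t^n] is equivalent in angle to
    [|arg p (t z0)| <= 2 alpha atan (t^n)]. The right side equals [alpha pi / 2] at [t = 1] and has
    slope [n alpha] there. The obstacle is the boundary: [z0] is known only as a contact point, and
    [w] need not be differentiable there, least of all at the vertex [p z0 = 0]. So Schwarz is used
    strictly inside the circle, and only [p] itself is differentiated at [z0], one-sidedly along the
    radius. At the vertex the angle gives nothing; there the same Schwarz estimate yields
    [|p (t z0)| >= (1 - t) / 4], using [alpha <= 1], which forbids [p' z0 = 0]. The maximum
    principle behind Schwarz is a second-derivative test: the second derivatives of a harmonic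
    function along two orthogonal directions are opposite, so a strictly subharmonic perturbation
    has no local maximum. This needs second complex derivatives of [p], hence three of [g], obtained
    by differentiating the power series term by term. *)

Definition is_Cderive (f : C -> C) (z l : C) : Prop := is_derive f z l.

Definition Ccontinuous (f : C -> C) (z : C) : Prop :=
  forall eps : R, (0 < eps)%R -> exists delta : R, (0 < delta)%R /\
    forall y, (Cmod (y - z) < delta)%R -> (Cmod (f y - f z) < eps)%R.

Lemma is_CderiveE (f : C -> C) (z l : C) :
  is_Cderive f z l <->
  forall eps : R, (0 < eps)%R -> exists delta : R, (0 < delta)%R /\
    forall y, (Cmod (y - z) < delta)%R ->
      (Cmod (f y - f z - (y - z) * l) <= eps * Cmod (y - z))%R.
Proof.
split.
- intros [_ Hd] eps He.
  specialize (Hd z (fun P H => H)).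
  destruct (Hd (mkposreal eps He)) as [d Hdd].
  exists d; split; [apply cond_pos|].
  intros y Hy; exact (Hdd y Hy).
- intros H; split; [apply is_linear_scal_l|].
  intros x Hx.
  replace x with z by (apply (is_filter_lim_locally_unique (V := AbsRing_NormedModule C_AbsRing)); exact Hx).
  intros eps.
  destruct (H eps (cond_pos eps)) as [d [Hd Hy]].
  exists (mkposreal d Hd); intros y; exact (Hy y).
Qed.

(** The product and chain rules are available with [C] as a module over itself. The two module
    structures share their norm, and the remainder condition sees nothing else. *)
Lemma is_Cderive_AbsRing (f : C -> C) (z l : C) :
  is_Cderive f z l <-> is_derive (V := AbsRing_NormedModule C_AbsRing) f z l.
Proof.
split; intros [_ Hd]; (split; [apply is_linear_scal_l | exact Hd]).
Qed.

Lemma is_Cderive_const (k z : C) : is_Cderive (fun _ => k) z 0.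
Proof. exact (is_derive_const (V := C_NormedModule) k z). Qed.

Lemma is_Cderive_id (z : C) : is_Cderive (fun y : C => y) z 1.
Proof. apply is_Cderive_AbsRing. exact (is_derive_id (K := C_AbsRing) z). Qed.

Lemma is_Cderive_plus (f g : C -> C) (z df dg : C) :
  is_Cderive f z df -> is_Cderive g z dg -> is_Cderive (fun y => f y + g y) z (df + dg).
Proof. exact (is_derive_plus (V := C_NormedModule) f g z df dg). Qed.

Lemma is_Cderive_minus (f g : C -> C) (z df dg : C) :
  is_Cderive f z df -> is_Cderive g z dg -> is_Cderive (fun y => f y - g y) z (df - dg).
Proof. exact (is_derive_minus (V := C_NormedModule) f g z df dg). Qed.

Lemma is_Cderive_mult (f g : C -> C) (z df dg : C) :
  is_Cderive f z df -> is_Cderive g z dg ->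
  is_Cderive (fun y => f y * g y) z (df * g z + f z * dg).
Proof.
rewrite !is_Cderive_AbsRing; intros Hf Hg.
exact (is_derive_mult (K := C_AbsRing) f g z df dg Hf Hg Cmult_comm).
Qed.

Lemma is_Cderive_comp (f g : C -> C) (z df dg : C) :
  is_Cderive f (g z) df -> is_Cderive g z dg -> is_Cderive (fun y => f (g y)) z (dg * df).
Proof.
rewrite !is_Cderive_AbsRing.
exact (is_derive_comp (K := C_AbsRing) (V := AbsRing_NormedModule C_AbsRing) f g z df dg).
Qed.

Lemma is_Cderive_ext_loc (f g : C -> C) (z l : C) (delta : R) :
  (0 < delta)%R -> (forall y, (Cmod (y - z) < delta)%R -> f y = g y) ->
  is_Cderive f z l -> is_Cderive g z l.
Proof.
intros Hd Hfg; rewrite !is_CderiveE; intros Hf eps He.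
destruct (Hf eps He) as [d [Hd' Hy]].
exists (Rmin delta d); split; [now apply Rmin_pos|].
intros y Hyd; rewrite <- !Hfg.
- apply Hy; eapply Rlt_le_trans; [exact Hyd|apply Rmin_r].
- replace (z - z) with (RtoC 0) by ring; now rewrite Cmod_0.
- eapply Rlt_le_trans; [exact Hyd|apply Rmin_l].
Qed.

Lemma Cmod_minus_sym (x y : C) : Cmod (x - y) = Cmod (y - x).
Proof. rewrite <- Cmod_opp; f_equal; ring. Qed.

Lemma Cmod_triangle_minus (x y : C) : (Cmod x - Cmod y <= Cmod (x - y))%R.
Proof.
pose proof (Cmod_triangle (x - y) y) as H.
replace (x - y + y) with x in H by ring; lra.
Qed.

Lemma is_Cderive_lipschitz (f : C -> C) (z l : C) :
  is_Cderive f z l -> exists delta : R, (0 < delta)%R /\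
    forall y, (Cmod (y - z) < delta)%R ->
      (Cmod (f y - f z) <= (Cmod l + 1) * Cmod (y - z))%R.
Proof.
rewrite is_CderiveE; intros H.
destruct (H 1%R Rlt_0_1) as [d [Hd Hy]]; exists d; split; [exact Hd|].
intros y Hyd; specialize (Hy y Hyd).
pose proof (Cmod_triangle (f y - f z - (y - z) * l) ((y - z) * l)) as HT.
replace (f y - f z - (y - z) * l + (y - z) * l) with (f y - f z) in HT by ring.
rewrite Cmod_mult in HT; lra.
Qed.

Lemma is_Cderive_continuous (f : C -> C) (z l : C) : is_Cderive f z l -> Ccontinuous f z.
Proof.
intros Hf; destruct (is_Cderive_lipschitz f z l Hf) as [d [Hd Hy]].
intros eps He; pose proof (Cmod_ge_0 l) as Hl.
exists (Rmin d (eps / (Cmod l + 2))); split.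
{ apply Rmin_pos; [exact Hd|]. apply Rdiv_lt_0_compat; lra. }
intros y Hyd.
assert (H1 : (Cmod (y - z) < d)%R) by (eapply Rlt_le_trans; [exact Hyd|apply Rmin_l]).
assert (H2 : (Cmod (y - z) < eps / (Cmod l + 2))%R) by (eapply Rlt_le_trans; [exact Hyd|apply Rmin_r]).
apply Rlt_div_r in H2; [|lra].
specialize (Hy y H1); pose proof (Cmod_ge_0 (y - z)); nra.
Qed.

(** The remainder is exactly [(y - z)^2 / (y z^2)]; for [|y| > |z| / 2] it is at most
    [2 |y - z|^2 / |z|^3], whence the radius [eps * Cmod z ^ 3 / 2]. *)
Lemma is_Cderive_inv_id (z : C) : z <> 0 -> is_Cderive (fun y => / y) z (- / (z * z)).
Proof.
intros Hz; apply is_CderiveE; intros eps He.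
assert (Hm : (0 < Cmod z)%R) by now apply Cmod_gt_0.
exists (Rmin (Cmod z / 2) (eps * Cmod z ^ 3 / 2)); split.
{ apply Rmin_pos; [lra|]. apply Rdiv_lt_0_compat; [|lra].
  apply Rmult_lt_0_compat; [lra|now apply pow_lt]. }
intros y Hy.
assert (H1 : (Cmod (y - z) < Cmod z / 2)%R) by (eapply Rlt_le_trans; [exact Hy|apply Rmin_l]).
assert (H2 : (Cmod (y - z) < eps * Cmod z ^ 3 / 2)%R) by (eapply Rlt_le_trans; [exact Hy|apply Rmin_r]).
assert (H3 : (Cmod z / 2 < Cmod y)%R).
{ pose proof (Cmod_triangle_minus z y) as HT; rewrite Cmod_minus_sym in HT; lra. }
assert (Hy0 : y <> 0) by (apply Cmod_gt_0; lra).
replace (/ y - / z - (y - z) * - / (z * z)) with ((y - z) * ((y - z) * (/ y * / (z * z))))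
  by (field; auto).
rewrite !Cmod_mult, !Cmod_inv, !Cmod_mult; auto using Cmult_neq_0.
rewrite (Rmult_comm eps); apply Rmult_le_compat_l; [apply Cmod_ge_0|].
rewrite <- Rinv_mult.
assert (Hzz : (0 < Cmod z * Cmod z)%R) by nra.
apply (Rle_div_l (Cmod (y - z)) eps); [apply Rmult_lt_0_compat; lra|].
apply Rlt_le; eapply Rlt_le_trans; [exact H2|].
replace (eps * Cmod z ^ 3 / 2)%R with (eps * (Cmod z / 2 * (Cmod z * Cmod z)))%R by (simpl; field).
apply Rmult_le_compat_l; [lra|]. apply Rmult_le_compat_r; lra.
Qed.

Lemma is_Cderive_inv (f : C -> C) (z l : C) :
  f z <> 0 -> is_Cderive f z l -> is_Cderive (fun y => / f y) z (- l / (f z * f z)).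
Proof.
intros Hz Hf.
replace (- l / (f z * f z)) with (l * (- / (f z * f z))) by (field; auto).
exact (is_Cderive_comp (fun y => / y) f z _ _ (is_Cderive_inv_id _ Hz) Hf).
Qed.

Lemma is_Cderive_div (f g : C -> C) (z df dg : C) :
  g z <> 0 -> is_Cderive f z df -> is_Cderive g z dg ->
  is_Cderive (fun y => f y / g y) z ((df * g z - f z * dg) / (g z * g z)).
Proof.
intros Hz Hf Hg.
replace ((df * g z - f z * dg) / (g z * g z))
  with (df * / g z + f z * (- dg / (g z * g z))) by (field; auto).
exact (is_Cderive_mult f (fun y => / g y) z _ _ Hf (is_Cderive_inv g z dg Hz Hg)).
Qed.

Lemma is_Cderive_eq (f : C -> C) (z l l' : C) : is_Cderive f z l -> l = l' -> is_Cderive f z l'.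
Proof. now intros H <-. Qed.

(** * Restriction to real curves *)

Lemma is_derive_RE (f : R -> R) (x l : R) :
  is_derive f x l <->
  forall eps : R, (0 < eps)%R -> exists delta : R, (0 < delta)%R /\
    forall y, (Rabs (y - x) < delta)%R ->
      (Rabs (f y - f x - (y - x) * l) <= eps * Rabs (y - x))%R.
Proof.
split.
- intros [_ Hd] eps He.
  specialize (Hd x (fun P H => H)).
  destruct (Hd (mkposreal eps He)) as [d Hdd].
  exists d; split; [apply cond_pos|].
  intros y Hy; exact (Hdd y Hy).
- intros H; split; [apply is_linear_scal_l|].
  intros x' Hx.
  replace x' with x by (apply (is_filter_lim_locally_unique (V := AbsRing_NormedModule R_AbsRing)); exact Hx).
  intros eps.
  destruct (H eps (cond_pos eps)) as [d [Hd Hy]].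
  exists (mkposreal d Hd); intros y; exact (Hy y).
Qed.

Lemma Rabs_Im_le_Cmod (z : C) : (Rabs (Im z) <= Cmod z)%R.
Proof. eapply Rle_trans; [|apply Rmax_Cmod]. apply Rmax_r. Qed.

Lemma is_derive_Re_real (f : C -> C) (x : R) (l : C) :
  is_Cderive f x l -> is_derive (fun t : R => Re (f t)) x (Re l).
Proof.
rewrite is_CderiveE, is_derive_RE; intros H eps He.
destruct (H eps He) as [d [Hd Hy]]; exists d; split; [exact Hd|].
intros y Hyd; specialize (Hy (RtoC y)).
rewrite <- RtoC_minus, Cmod_R in Hy.
eapply Rle_trans; [|exact (Hy Hyd)].
replace (Re (f y) - Re (f x) - (y - x) * Re l)%R
  with (Re (f y - f x - (y - x)%R * l)) by (unfold Re; simpl; ring).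
apply re_le_Cmod.
Qed.

Lemma is_derive_Im_real (f : C -> C) (x : R) (l : C) :
  is_Cderive f x l -> is_derive (fun t : R => Im (f t)) x (Im l).
Proof.
rewrite is_CderiveE, is_derive_RE; intros H eps He.
destruct (H eps He) as [d [Hd Hy]]; exists d; split; [exact Hd|].
intros y Hyd; specialize (Hy (RtoC y)).
rewrite <- RtoC_minus, Cmod_R in Hy.
eapply Rle_trans; [|exact (Hy Hyd)].
replace (Im (f y) - Im (f x) - (y - x) * Im l)%R
  with (Im (f y - f x - (y - x)%R * l)) by (unfold Im; simpl; ring).
apply Rabs_Im_le_Cmod.
Qed.

Lemma continuous_CRE (F : C -> R) (z : C) :
  continuous (T := C_UniformSpace) (U := R_UniformSpace) F z <->
  forall eps : R, (0 < eps)%R -> exists delta : R, (0 < delta)%R /\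
    forall y, (Cmod (y - z) < delta)%R -> (Rabs (F y - F z) < eps)%R.
Proof.
split.
- intros H eps He.
  specialize (H (ball (F z) (mkposreal eps He)) (locally_ball (F z) (mkposreal eps He))).
  destruct H as [d Hd]; exists d; split; [apply cond_pos|].
  intros y Hy; apply (Hd y). now apply C_NormedModule_mixin_compat1.
- intros H P [eps HP].
  destruct (H eps (cond_pos eps)) as [d [Hd Hy]].
  (* Balls of [C_UniformSpace] are squares; one of half-side [d / sqrt 2] lies inside the disc of
     radius [d]. *)
  assert (Hd' : (0 < d / sqrt 2)%R) by (apply Rdiv_lt_0_compat; [exact Hd|apply sqrt_lt_R0; lra]).
  exists (mkposreal _ Hd'); intros y Hb; apply HP, Hy.
  replace d with (sqrt 2 * (d / sqrt 2))%R.
  + exact (C_NormedModule_mixin_compat2 z y (mkposreal _ Hd') Hb).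
  + field; apply Rgt_not_eq, sqrt_lt_R0; lra.
Qed.

Lemma Ccontinuous_Re (f : C -> C) (z : C) : Ccontinuous f z ->
  continuous (T := C_UniformSpace) (U := R_UniformSpace) (fun y => Re (f y)) z.
Proof.
intros H; apply continuous_CRE; intros eps He; destruct (H eps He) as [d [Hd Hy]].
exists d; split; [exact Hd|]; intros y Hyd.
eapply Rle_lt_trans; [|exact (Hy y Hyd)]; exact (re_le_Cmod (f y - f z)).
Qed.

Lemma Ccontinuous_Im (f : C -> C) (z : C) : Ccontinuous f z ->
  continuous (T := C_UniformSpace) (U := R_UniformSpace) (fun y => Im (f y)) z.
Proof.
intros H; apply continuous_CRE; intros eps He; destruct (H eps He) as [d [Hd Hy]].
exists d; split; [exact Hd|]; intros y Hyd.
eapply Rle_lt_trans; [|exact (Hy y Hyd)]; exact (Rabs_Im_le_Cmod (f y - f z)).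
Qed.

Lemma Ccontinuous_Cmod (f : C -> C) (z : C) : Ccontinuous f z ->
  continuous (T := C_UniformSpace) (U := R_UniformSpace) (fun y => Cmod (f y)) z.
Proof.
intros H; apply continuous_CRE; intros eps He; destruct (H eps He) as [d [Hd Hy]].
exists d; split; [exact Hd|]; intros y Hyd.
eapply Rle_lt_trans; [|exact (Hy y Hyd)].
pose proof (Cmod_triangle_minus (f y) (f z)) as H1.
pose proof (Cmod_triangle_minus (f z) (f y)) as H2.
rewrite (Cmod_minus_sym (f z)) in H2.
apply Rabs_le; lra.
Qed.

Lemma Cmod_le_Re_Im (z : C) : (Cmod z <= Rabs (Re z) + Rabs (Im z))%R.
Proof.
replace z with (RtoC (Re z) + (0, Im z)%R) at 1.
2:{ destruct z as [x y]; unfold RtoC, Re, Im, Cplus; simpl; f_equal; ring. }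
eapply Rle_trans; [apply Cmod_triangle|].
rewrite Cmod_R; apply Rplus_le_compat_l.
unfold Cmod; simpl.
rewrite <- sqrt_Rsqr_abs; apply Req_le; f_equal; unfold Rsqr; ring.
Qed.

Lemma Ccontinuous_Re_Im (f : C -> C) (z : C) :
  continuous (T := C_UniformSpace) (U := R_UniformSpace) (fun y => Re (f y)) z ->
  continuous (T := C_UniformSpace) (U := R_UniformSpace) (fun y => Im (f y)) z ->
  Ccontinuous f z.
Proof.
rewrite !continuous_CRE; intros HR HI eps He.
destruct (HR (eps / 2)%R ltac:(lra)) as [d1 [Hd1 H1]].
destruct (HI (eps / 2)%R ltac:(lra)) as [d2 [Hd2 H2]].
exists (Rmin d1 d2); split; [now apply Rmin_pos|]; intros y Hy.
specialize (H1 y ltac:(eapply Rlt_le_trans; [exact Hy|apply Rmin_l])).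
specialize (H2 y ltac:(eapply Rlt_le_trans; [exact Hy|apply Rmin_r])).
eapply Rle_lt_trans; [apply Cmod_le_Re_Im|].
unfold Re, Im in *; simpl in *.
unfold Rminus in *; lra.
Qed.

(** * Exponential and logarithm *)

Lemma Cexp_plus (x y : C) : Cexp (x + y) = Cexp x * Cexp y.
Proof.
unfold Cexp, Cmult, Cplus, Re, Im; simpl.
rewrite exp_plus, cos_plus, sin_plus; f_equal; ring.
Qed.

Lemma Cmod_Cexp (z : C) : Cmod (Cexp z) = exp (Re z).
Proof.
assert (H : (Cmod (Cexp z) ^ 2 = exp (Re z) ^ 2)%R).
{ rewrite Cmod2_alt; unfold Cexp; simpl.
  pose proof (sin2_cos2 (Im z)) as H; unfold Rsqr in H.
  transitivity (exp (Re z) * exp (Re z) * (sin (Im z) * sin (Im z) + cos (Im z) * cos (Im z)))%R; [|rewrite H]; ring. }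
pose proof (Cmod_ge_0 (Cexp z)); pose proof (exp_pos (Re z)); nra.
Qed.

Lemma Cexp_0 : Cexp 0 = 1.
Proof. unfold Cexp; simpl; rewrite exp_0, cos_0, sin_0; unfold RtoC; f_equal; ring. Qed.

(** For [y = a + i b] the remainder has real part [(e^a - 1 - a) + e^a (cos b - 1)] and imaginary
    part [(sin b - b) + (e^a - 1) sin b], and the real derivatives at 0 control each piece. *)
Lemma is_Cderive_Cexp_0 : is_Cderive Cexp 0 1.
Proof.
apply is_CderiveE; intros eps He.
assert (Hexp : is_derive exp 0 1%R) by (auto_derive; [trivial|rewrite exp_0; ring]).
assert (Hcos : is_derive cos 0 0%R) by (auto_derive; [trivial|rewrite sin_0; ring]).
assert (Hsin : is_derive sin 0 1%R) by (auto_derive; [trivial|rewrite cos_0; ring]).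
(* Budget, in multiples of [|y|]: the pieces linear in [e] cost [e + 3 e + e <= 5 eps / 8], and the
   product [(e^a - 1) sin b] costs [4 |y| <= eps / 4] once [|y| < eps / 16]. *)
set (e := (Rmin 1 (eps / 8))%R).
assert (He' : (0 < e)%R) by (apply Rmin_pos; lra).
assert (He1 : (e <= 1)%R) by apply Rmin_l.
assert (He8 : (e <= eps / 8)%R) by apply Rmin_r.
clearbody e.
rewrite is_derive_RE in Hexp, Hcos, Hsin.
destruct (Hexp e He') as [d1 [Hd1 H1]].
destruct (Hcos e He') as [d2 [Hd2 H2]].
destruct (Hsin e He') as [d3 [Hd3 H3]].
exists (Rmin (Rmin d1 (eps / 16)) (Rmin (Rmin d2 d3) 1)); split.
{ repeat apply Rmin_pos; lra. }
intros y Hy.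
replace (y - 0) with y in * by ring.
rewrite Cexp_0.
assert (Hm1 : (Cmod y < d1 /\ Cmod y < d2 /\ Cmod y < d3 /\ Cmod y < 1 /\ Cmod y < eps / 16)%R).
{ pose proof (Rmin_l (Rmin d1 (eps / 16)) (Rmin (Rmin d2 d3) 1)).
  pose proof (Rmin_r (Rmin d1 (eps / 16)) (Rmin (Rmin d2 d3) 1)).
  pose proof (Rmin_l d1 (eps / 16)); pose proof (Rmin_r d1 (eps / 16)).
  pose proof (Rmin_l (Rmin d2 d3) 1); pose proof (Rmin_r (Rmin d2 d3) 1).
  pose proof (Rmin_l d2 d3); pose proof (Rmin_r d2 d3). lra. }
destruct Hm1 as [M1 [M2 [M3 [M4 M5]]]].
pose proof (re_le_Cmod y) as Hre; pose proof (Rabs_Im_le_Cmod y) as Him.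
specialize (H1 (Re y)); specialize (H2 (Im y)); specialize (H3 (Im y)).
rewrite Rminus_0_r in H1, H2, H3.
specialize (H1 ltac:(lra)); specialize (H2 ltac:(lra)); specialize (H3 ltac:(lra)).
rewrite exp_0, Rmult_1_r in H1; rewrite cos_0, Rmult_0_r, Rminus_0_r in H2.
rewrite sin_0, Rmult_1_r, Rminus_0_r in H3.
assert (Hex : (Rabs (exp (Re y) - 1) <= 2 * Cmod y)%R).
{ replace (exp (Re y) - 1)%R with ((exp (Re y) - 1 - Re y) + Re y)%R by ring.
  eapply Rle_trans; [apply Rabs_triang|].
  pose proof (Rabs_pos (Re y)); nra. }
assert (Hex3 : (Rabs (exp (Re y)) <= 3)%R).
{ replace (exp (Re y)) with ((exp (Re y) - 1) + 1)%R by ring.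
  eapply Rle_trans; [apply Rabs_triang|]; rewrite Rabs_R1; lra. }
eapply Rle_trans; [apply Cmod_le_Re_Im|].
replace (Re (Cexp y - 1 - y * 1))
  with ((exp (Re y) - 1 - Re y) + exp (Re y) * (cos (Im y) - 1))%R
  by (unfold Cexp, Re, Im; simpl; ring).
replace (Im (Cexp y - 1 - y * 1))
  with ((sin (Im y) - Im y) + (exp (Re y) - 1) * sin (Im y))%R
  by (unfold Cexp, Re, Im; simpl; ring).
assert (Hs : (Rabs (sin (Im y)) <= 2 * Cmod y)%R).
{ replace (sin (Im y)) with ((sin (Im y) - Im y) + Im y)%R by ring.
  eapply Rle_trans; [apply Rabs_triang|].
  pose proof (Rabs_pos (Im y)); nra. }
pose proof (Rabs_triang (exp (Re y) - 1 - Re y) (exp (Re y) * (cos (Im y) - 1))) as T1.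
pose proof (Rabs_triang (sin (Im y) - Im y) ((exp (Re y) - 1) * sin (Im y))) as T2.
rewrite Rabs_mult in T1, T2.
pose proof (Rabs_pos (exp (Re y))); pose proof (Rabs_pos (exp (Re y) - 1)).
pose proof (Rabs_pos (cos (Im y) - 1)); pose proof (Rabs_pos (sin (Im y))).
pose proof (Rabs_pos (Re y)); pose proof (Rabs_pos (Im y)).
assert (K1 : (Rabs (exp (Re y)) * Rabs (cos (Im y) - 1) <= 3 * (e * Cmod y))%R).
{ apply Rmult_le_compat; nra. }
assert (K2 : (Rabs (exp (Re y) - 1) * Rabs (sin (Im y)) <= (2 * Cmod y) * (2 * Cmod y))%R).
{ apply Rmult_le_compat; nra. }
nra.
Qed.

Lemma is_Cderive_Cexp (z : C) : is_Cderive Cexp z (Cexp z).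
Proof.
apply (is_Cderive_ext_loc (fun y => Cexp z * Cexp (y - z)) _ _ _ 1 Rlt_0_1).
{ intros y _; rewrite <- Cexp_plus; f_equal; ring. }
eapply is_Cderive_eq.
- apply is_Cderive_mult; [apply is_Cderive_const|].
  apply (is_Cderive_comp Cexp (fun y => y - z)).
  + replace (z - z) with (RtoC 0) by ring; apply is_Cderive_Cexp_0.
  + apply is_Cderive_minus; [apply is_Cderive_id|apply is_Cderive_const].
- cbv beta; ring.
Qed.

(* Principal logarithm on the right half-plane [Re w > 0]. *)
Definition Clog (w : C) : C := (ln (Cmod w), atan (Im w / Re w)).

Lemma Cmod_gt_0_Re (w : C) : (0 < Re w)%R -> (0 < Cmod w)%R.
Proof.
intros Hw; pose proof (re_le_Cmod w) as H; rewrite Rabs_pos_eq in H; lra.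
Qed.

Lemma Cmod_atan (w : C) : (0 < Re w)%R ->
  (Cmod w = Re w * sqrt (1 + (Im w / Re w) ^ 2))%R.
Proof.
intros Hw.
rewrite <- (sqrt_pow2 (Re w)) at 1 by lra.
rewrite <- sqrt_mult_alt by nra.
unfold Cmod; f_equal; unfold Re, Im in *; field; lra.
Qed.

Lemma Cexp_Clog (w : C) : (0 < Re w)%R -> Cexp (Clog w) = w.
Proof.
intros Hw; pose proof (Cmod_gt_0_Re w Hw) as Hm.
unfold Cexp, Clog; cbn [Re Im fst snd].
change (Re (ln (Cmod w), atan (Im w / Re w))) with (ln (Cmod w)).
change (Im (ln (Cmod w), atan (Im w / Re w))) with (atan (Im w / Re w)).
rewrite exp_ln, cos_atan, sin_atan, (Cmod_atan w Hw) by exact Hm.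
assert (Hs : (0 < sqrt (1 + (Im w / Re w) ^ 2))%R).
{ apply sqrt_lt_R0; pose proof (pow2_ge_0 (Im w / Re w)); lra. }
unfold Rsqr; replace (Im w / Re w * (Im w / Re w))%R with ((Im w / Re w) ^ 2)%R by ring.
set (s := sqrt _) in *; clearbody s.
apply injective_projections; unfold Re, Im in *; simpl; field; lra.
Qed.

Lemma Ccontinuous_Clog (w : C) : (0 < Re w)%R -> Ccontinuous Clog w.
Proof.
intros Hw; pose proof (Cmod_gt_0_Re w Hw) as Hm.
assert (Hid : Ccontinuous (fun y => y) w) by exact (is_Cderive_continuous _ _ _ (is_Cderive_id w)).
apply Ccontinuous_Re_Im.
- change (continuous (T := C_UniformSpace) (U := R_UniformSpace) (fun y : C => ln (Cmod y)) w).
  apply (continuous_comp (U := C_UniformSpace) Cmod ln).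
  + exact (Ccontinuous_Cmod _ _ Hid).
  + apply (ex_derive_continuous ln (Cmod w)); exists (/ Cmod w)%R; now apply is_derive_ln.
- change (continuous (T := C_UniformSpace) (U := R_UniformSpace) (fun y : C => atan (Im y / Re y)) w).
  apply (continuous_comp (U := C_UniformSpace) (fun y : C => (Im y / Re y)%R) atan).
  + apply (continuous_mult (U := C_UniformSpace) (K := R_AbsRing) (fun y : C => Im y) (fun y : C => (/ Re y)%R)).
    * exact (Ccontinuous_Im _ _ Hid).
    * apply (continuous_comp (U := C_UniformSpace) (fun y : C => Re y) Rinv).
      -- exact (Ccontinuous_Re _ _ Hid).
      -- apply (ex_derive_continuous Rinv (Re w)); auto_derive; lra.
  + apply (ex_derive_continuous atan); auto_derive; trivial.
Qed.

(** Inverse-function argument: with [L = Clog y - Clog w], the derivative of [Cexp] gives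
    [|y - w - L w| <= e |L|]. The choice [e <= |w| / 2] makes [|L|] comparable to [|y - w|], and
    dividing by [w] turns this into the remainder of [Clog]. *)
Lemma is_Cderive_Clog (w : C) : (0 < Re w)%R -> is_Cderive Clog w (/ w).
Proof.
intros Hw; pose proof (Cmod_gt_0_Re w Hw) as Hm.
apply is_CderiveE; intros eps He.
pose proof (is_Cderive_Cexp (Clog w)) as HE; rewrite Cexp_Clog in HE by exact Hw.
rewrite is_CderiveE in HE.
set (e := Rmin (Cmod w / 2) (eps * Cmod w * Cmod w / 2)).
assert (He' : (0 < e)%R).
{ apply Rmin_pos; [lra|]. apply Rdiv_lt_0_compat; [|lra]. repeat apply Rmult_lt_0_compat; lra. }
assert (He1 : (e <= Cmod w / 2)%R) by apply Rmin_l.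
assert (He2 : (e <= eps * Cmod w * Cmod w / 2)%R) by apply Rmin_r.
clearbody e.
destruct (HE e He') as [d1 [Hd1 H1]].
destruct (Ccontinuous_Clog w Hw d1 Hd1) as [d2 [Hd2 H2]].
exists (Rmin d2 (Re w)); split; [apply Rmin_pos; lra|].
intros y Hy.
assert (Y2 : (Cmod (y - w) < d2)%R) by (eapply Rlt_le_trans; [exact Hy|apply Rmin_l]).
assert (Yr : (Cmod (y - w) < Re w)%R) by (eapply Rlt_le_trans; [exact Hy|apply Rmin_r]).
assert (Hyr : (0 < Re y)%R).
{ pose proof (re_le_Cmod (y - w)) as T; apply Rabs_le_between in T.
  unfold Re in *; simpl in *; lra. }
specialize (H1 (Clog y) (H2 y Y2)); rewrite !Cexp_Clog in H1 by assumption.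
assert (Hw0 : w <> 0) by now apply Cmod_gt_0.
set (L := Clog y - Clog w) in *.
assert (HL : (Cmod w / 2 * Cmod L <= Cmod (y - w))%R).
{ pose proof (Cmod_triangle_minus (L * w) (-(y - w - L * w))) as T.
  rewrite Cmod_opp, Cmod_mult in T.
  replace (L * w - - (y - w - L * w)) with (y - w) in T by ring.
  pose proof (Cmod_ge_0 L); nra. }
replace (L - (y - w) * / w) with (- (y - w - L * w) * / w) by (field; auto).
rewrite Cmod_mult, Cmod_inv, Cmod_opp by exact Hw0.
apply (Rle_div_l _ _ _ Hm).
eapply Rle_trans; [exact H1|].
apply Rle_trans with (eps * Cmod w * (Cmod w / 2 * Cmod L))%R.
- pose proof (Cmod_ge_0 L); nra.
- replace (eps * Cmod (y - w) * Cmod w)%R with (eps * Cmod w * Cmod (y - w))%R by ring.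
  apply Rmult_le_compat_l; [|exact HL]. apply Rmult_le_pos; lra.
Qed.

(** * Maximum principle and Schwarz lemma *)

(** Upper semicontinuity relative to [A] suffices. If the supremum [S] were not attained, every
    point would have a neighbourhood on which [F] stays a fixed amount below [S]; compactness of a
    square makes that amount uniform, against the definition of [S]. *)
Lemma compact_max (A : C -> Prop) (F : C -> R) (M B : R) :
  (exists z, A z) -> (forall z, A z -> (Cmod z <= M)%R) -> (forall z, A z -> (F z <= B)%R) ->
  (forall z, ~ A z -> exists delta : R, (0 < delta)%R /\
     forall y, (Cmod (y - z) < delta)%R -> ~ A y) ->
  (forall z, A z -> forall eps, (0 < eps)%R -> exists delta : R, (0 < delta)%R /\
     forall y, A y -> (Cmod (y - z) < delta)%R -> (F y < F z + eps)%R) ->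
  exists z, A z /\ forall y, A y -> (F y <= F z)%R.
Proof.
intros [z0 Hz0] HM HB Hcl Husc.
destruct (completeness (fun v => exists z, A z /\ v = F z)) as [S [HS1 HS2]].
{ exists B; intros v [z [Hz ->]]; auto. }
{ exists (F z0), z0; auto. }
destruct (classic (exists z, A z /\ (S <= F z)%R)) as [[z [Hz HSz]]|Hno].
{ exists z; split; [exact Hz|]; intros y Hy; apply Rle_trans with S; [|exact HSz].
  apply HS1; exists y; auto. }
exfalso.
(* Points outside [A] are included so that the radii are defined on the whole square. The radius is
   [2 * d] because compactness controls both coordinates by [d], hence the modulus by their sum. *)
assert (Hloc : forall z : C, exists d : posreal, forall y, (Cmod (y - z) < 2 * d)%R -> A y -> (F y < S - d)%R).
{ intros z; destruct (classic (A z)) as [Hz|Hz].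
  - assert (HSz : (F z < S)%R) by (apply Rnot_le_lt; intros H; apply Hno; eauto).
    destruct (Husc z Hz ((S - F z) / 2)%R ltac:(lra)) as [d [Hd Hy]].
    assert (Hp : (0 < Rmin (d / 2) ((S - F z) / 2))%R) by (apply Rmin_pos; lra).
    exists (mkposreal _ Hp); intros y Hyd Hya; cbn [pos] in *.
    pose proof (Rmin_l (d / 2) ((S - F z) / 2)); pose proof (Rmin_r (d / 2) ((S - F z) / 2)).
    specialize (Hy y Hya ltac:(lra)); lra.
  - destruct (Hcl z Hz) as [d [Hd Hy]].
    assert (Hp : (0 < d / 2)%R) by lra.
    exists (mkposreal _ Hp); intros y Hyd Hya; cbn [pos] in *.
    exfalso; apply (Hy y); [lra|exact Hya]. }
pose (delta := fun x y : R => proj1_sig (constructive_indefinite_description _ (Hloc (x, y)))).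
destruct (compactness_value_2d (- M) M (- M) M delta) as [d Hd].
pose proof (cond_pos d) as Hdp.
assert (HSd : (S <= S - d)%R); [|lra].
apply HS2; intros v [z [Hz ->]].
apply Rnot_lt_le; intros Hlt.
pose proof (re_le_Cmod z) as Hr; pose proof (Rabs_Im_le_Cmod z) as Hi; specialize (HM z Hz).
apply (Hd (Re z) (Im z)).
{ apply Rabs_le_between; lra. }
{ apply Rabs_le_between; lra. }
intros [x [y [_ [_ [Hx [Hy Hdd]]]]]].
unfold delta in Hx, Hy, Hdd.
destruct (constructive_indefinite_description _ (Hloc (x, y))) as [e He]; cbn [proj1_sig] in *.
assert (HzA : (F z < S - e)%R); [|lra].
apply He; [|exact Hz].
eapply Rle_lt_trans; [apply Cmod_le_Re_Im|].
unfold Re, Im in *; simpl; unfold Rminus in *; lra.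
Qed.

Lemma derivative_local_max (u : R -> R) (l delta : R) :
  (0 < delta)%R -> (forall s, (Rabs s < delta)%R -> (u s <= u 0)%R) -> is_derive u 0%R l -> l = 0%R.
Proof.
intros Hd Hu; rewrite is_derive_RE; intros H.
destruct (Req_dec l 0) as [->|Hl]; [reflexivity|exfalso].
pose proof (Rabs_pos_lt l Hl) as Hlp.
destruct (H (Rabs l / 2)%R ltac:(lra)) as [d [Hd' Hy]].
set (e := (Rmin delta d / 2)%R).
assert (He : (0 < e /\ e < delta /\ e < d)%R).
{ pose proof (Rmin_pos _ _ Hd Hd'); pose proof (Rmin_l delta d); pose proof (Rmin_r delta d); unfold e; lra. }
destruct (Rle_lt_dec l 0) as [Hneg|Hpos].
- specialize (Hu (- e)%R); specialize (Hy (- e)%R).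
  rewrite Rminus_0_r, Rabs_Ropp, (Rabs_pos_eq e) in * by lra.
  rewrite (Rabs_left l) in * by lra.
  specialize (Hu ltac:(lra)); specialize (Hy ltac:(lra)).
  apply Rabs_le_between in Hy; nra.
- specialize (Hu e); specialize (Hy e).
  rewrite Rminus_0_r, (Rabs_pos_eq e) in * by lra.
  rewrite (Rabs_pos_eq l) in * by lra.
  specialize (Hu ltac:(lra)); specialize (Hy ltac:(lra)).
  apply Rabs_le_between in Hy; nra.
Qed.

(** If [c > 0], then according to the sign of [u1 0] either [u1 > 0] just to the right of 0 or
    [u1 < 0] just to the left; the mean value theorem then produces a value above [u 0]. *)
Lemma second_derivative_local_max (u u1 : R -> R) (c delta : R) :
  (0 < delta)%R -> (forall s, (Rabs s < delta)%R -> is_derive u s (u1 s)) ->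
  (forall s, (Rabs s < delta)%R -> (u s <= u 0)%R) -> is_derive u1 0%R c -> (c <= 0)%R.
Proof.
intros Hd Hu1 Hu; rewrite is_derive_RE; intros H.
apply Rnot_lt_le; intros Hc.
destruct (H (c / 2)%R ltac:(lra)) as [d [Hd' Hy]].
set (e := (Rmin delta d / 2)%R).
assert (He : (0 < e /\ e < delta /\ e < d)%R).
{ pose proof (Rmin_pos _ _ Hd Hd'); pose proof (Rmin_l delta d); pose proof (Rmin_r delta d); unfold e; lra. }
destruct (Rle_lt_dec 0 (u1 0%R)) as [Hpos|Hneg].
- destruct (MVT_cor2 u u1 0 e ltac:(lra)) as [x [Hx Hx']].
  { intros x Hx; apply is_derive_Reals, Hu1; rewrite Rabs_pos_eq; lra. }
  specialize (Hu e); rewrite (Rabs_pos_eq e) in Hu by lra; specialize (Hu ltac:(lra)).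
  specialize (Hy x); rewrite Rminus_0_r, (Rabs_pos_eq x) in Hy by lra; specialize (Hy ltac:(lra)).
  apply Rabs_le_between in Hy.
  assert (0 < u1 x)%R by nra. nra.
- destruct (MVT_cor2 u u1 (- e) 0 ltac:(lra)) as [x [Hx Hx']].
  { intros x Hx; apply is_derive_Reals, Hu1; rewrite <- Rabs_Ropp, Rabs_pos_eq; lra. }
  specialize (Hu (- e)%R); rewrite Rabs_Ropp, (Rabs_pos_eq e) in Hu by lra; specialize (Hu ltac:(lra)).
  specialize (Hy x); rewrite Rminus_0_r, <- Rabs_Ropp, (Rabs_pos_eq (- x)) in Hy by lra; specialize (Hy ltac:(lra)).
  apply Rabs_le_between in Hy.
  assert (u1 x < 0)%R by nra. nra.
Qed.

Lemma is_derive_ln_sqrt_sum_sq (f g : R -> R) (x df dg : R) :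
  (0 < f x ^ 2 + g x ^ 2)%R -> is_derive f x df -> is_derive g x dg ->
  is_derive (fun t : R => ln (sqrt (f t ^ 2 + g t ^ 2))) x
    ((df * f x + dg * g x) / (f x ^ 2 + g x ^ 2))%R.
Proof.
intros Hm Hf Hg.
assert (Hs : (0 < sqrt (f x ^ 2 + g x ^ 2))%R) by now apply sqrt_lt_R0.
pose proof (sqrt_sqrt _ (Rlt_le _ _ Hm)) as Hss.
auto_derive.
- change (f x * (f x * 1) + g x * (g x * 1))%R with (f x ^ 2 + g x ^ 2)%R.
  repeat split; try assumption; eexists; eassumption.
- change (Derive (fun t => f t) x) with (Derive f x); change (Derive (fun t => g t) x) with (Derive g x).
  rewrite (is_derive_unique f x df Hf), (is_derive_unique g x dg Hg).
  change (f x * (f x * 1) + g x * (g x * 1))%R with (f x ^ 2 + g x ^ 2)%R.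
  set (s := sqrt _) in *; clearbody s.
  rewrite <- Hss; field; lra.
Qed.

(** This is the real part of the derivative of a local logarithm of [f], computed through [Re] and
    [Im] so that no branch has to be chosen. *)
Lemma is_derive_ln_Cmod (f : C -> C) (x : R) (l : C) :
  f x <> 0 -> is_Cderive f x l ->
  is_derive (fun t : R => ln (Cmod (f t))) x (Re (l / f x)).
Proof.
intros Hx Hf.
assert (Hm : (0 < Re (f x) ^ 2 + Im (f x) ^ 2)%R).
{ rewrite <- Cmod2_alt; apply pow_lt; now apply Cmod_gt_0. }
replace (Re (l / f x)) with ((Re l * Re (f x) + Im l * Im (f x)) / (Re (f x) ^ 2 + Im (f x) ^ 2))%R.
2:{ unfold Cdiv, Cinv, Cmult, Re, Im in *; cbn [fst snd]; field; lra. }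
exact (is_derive_ln_sqrt_sum_sq (fun t : R => Re (f t)) (fun t : R => Im (f t)) x _ _ Hm
  (is_derive_Re_real f x l Hf) (is_derive_Im_real f x l Hf)).
Qed.

(* [ln |w| - m ln |y|] is harmonic, and adding [eps |y|^2] makes it strictly subharmonic. *)
Lemma no_local_max_log (w Q : C -> C) (z q : C) (m eps delta : R) :
  (0 < eps)%R -> (0 < delta)%R ->
  (forall y, (Cmod (y - z) < delta)%R ->
     w y <> 0 /\ y <> 0 /\ is_Cderive w y (w y * Q y)) ->
  is_Cderive Q z q ->
  ~ (forall y, (Cmod (y - z) < delta)%R ->
       (ln (Cmod (w y)) + eps * Cmod y ^ 2 - m * ln (Cmod y) <=
        ln (Cmod (w z)) + eps * Cmod z ^ 2 - m * ln (Cmod z))%R).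
Proof.
intros He Hd Hw Hq Hmax.
assert (Hz0 : z <> 0).
{ apply (Hw z); replace (z - z) with (RtoC 0) by ring; now rewrite Cmod_0. }
(* [q + m / z^2] is the derivative at [z] of [Q - m / y], the logarithmic derivative of [w / y^m].
   The second derivative of the harmonic part along [d] is [Re (d^2 (q + m / z^2))], which changes
   sign between [d = 1] and [d = i]; one of the two makes it nonnegative. *)
assert (Hdir : exists d : C, Cmod d = 1%R /\ (0 <= Re (d * d * (q + m / (z * z)))%C)%R).
{ destruct (Rle_lt_dec 0 (Re (q + m / (z * z)))) as [H|H].
  - exists 1; split; [apply Cmod_1|].
    replace (1 * 1 * (q + m / (z * z))) with (q + m / (z * z)) by ring; exact H.
  - exists Ci; split; [apply Cmod_Ci|].
    replace (Ci * Ci * (q + m / (z * z))) with (- (q + m / (z * z)))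
      by (unfold Ci, Cmult, Copp, Cplus; simpl; f_equal; ring).
    unfold Re in *; simpl in *; lra. }
destruct Hdir as [d [Hd1 Hdq]].
assert (Hd2 : (Re d ^ 2 + Im d ^ 2 = 1)%R).
{ rewrite <- Cmod2_alt, Hd1; ring. }
assert (Hnear : forall s : R, (Rabs s < delta)%R -> (Cmod (z + s * d - z) < delta)%R).
{ intros s Hs; replace (z + s * d - z) with (s * d) by ring.
  rewrite Cmod_mult, Cmod_R, Hd1; lra. }
assert (Hline : forall x : C, is_Cderive (fun s => z + s * d) x d).
{ intros x; eapply is_Cderive_eq.
  - apply is_Cderive_plus; [apply is_Cderive_const|].
    apply is_Cderive_mult; [apply is_Cderive_id|apply is_Cderive_const].
  - cbv beta; ring. }
set (T := fun y => Q y - m / y).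
assert (HT : is_Cderive T z (q + m / (z * z))).
{ eapply is_Cderive_eq.
  - apply is_Cderive_minus; [exact Hq|].
    apply is_Cderive_div; [exact Hz0|apply is_Cderive_const|apply is_Cderive_id].
  - cbv beta; field; exact Hz0. }
set (u := fun s : R => (ln (Cmod (w (z + s * d)%C)) + eps * Cmod (z + s * d)%C ^ 2
                         - m * ln (Cmod (z + s * d)%C))%R).
set (u1 := fun s : R => (Re (d * T (z + s * d))%C
   + eps * (2 * (Re z + s * Re d) * Re d + 2 * (Im z + s * Im d) * Im d))%R).
assert (Hc : (Re (d * d * (q + m / (z * z)))%C + 2 * eps <= 0)%R); [|lra].
apply (second_derivative_local_max u u1 _ delta Hd).
- intros s Hs; destruct (Hw _ (Hnear s Hs)) as [W0 [W1 W2]].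
  pose proof (is_derive_ln_Cmod (fun t => w (z + t * d)) s _ W0
     (is_Cderive_comp w (fun t => z + t * d) _ _ _ W2 (Hline s))) as L1.
  pose proof (is_derive_ln_Cmod (fun t => z + t * d) s _ W1 (Hline s)) as L2.
  assert (L3 : is_derive (fun t : R => (eps * Cmod (z + t * d)%C ^ 2)%R) s
    (eps * (2 * (Re z + s * Re d) * Re d + 2 * (Im z + s * Im d) * Im d))%R).
  { apply (is_derive_ext (fun t : R => (eps * ((Re z + t * Re d) ^ 2 + (Im z + t * Im d) ^ 2))%R)).
    { intros t; rewrite Cmod2_alt; unfold Re, Im; simpl; ring. }
    auto_derive; [trivial|ring]. }
  pose proof (is_derive_plus _ _ _ _ _ L1 L3) as L4.
  pose proof (is_derive_minus _ _ _ _ _ L4 (is_derive_scal _ s m _ L2)) as L5.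
  refine (eq_ind _ (fun l => is_derive u s l) L5 _ _).
  unfold u1, T, minus, plus, opp; cbn -[Re Im Cmod Cmult Cdiv Cminus].
  replace (d * (w (z + s * d) * Q (z + s * d)) / w (z + s * d)) with (d * Q (z + s * d)) by (field; exact W0).
  replace (d * (Q (z + s * d) - m / (z + s * d))) with (d * Q (z + s * d) - m * (d / (z + s * d)))
    by (field; exact W1).
  unfold Re at 5; simpl; unfold Re, Im; simpl; ring.
- intros s Hs; unfold u.
  replace (z + 0%R * d) with z by ring; apply Hmax, Hnear, Hs.
- assert (HD : is_Cderive (fun t => d * T (z + t * d)) 0%R (d * d * (q + m / (z * z)))).
  { eapply is_Cderive_eq.
    - apply is_Cderive_mult; [apply is_Cderive_const|].
      apply (is_Cderive_comp T (fun t => z + t * d)); [|apply Hline].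
      replace (z + 0%R * d) with z by ring; exact HT.
    - cbv beta; ring. }
  pose proof (is_derive_Re_real _ _ _ HD) as L1.
  assert (L2 : is_derive (fun s : R => (eps * (2 * (Re z + s * Re d) * Re d + 2 * (Im z + s * Im d) * Im d))%R)
     0%R (2 * eps)%R).
  { auto_derive; [trivial|]. transitivity (2 * eps * (Re d ^ 2 + Im d ^ 2))%R; [ring|rewrite Hd2; ring]. }
  exact (is_derive_plus _ _ _ _ _ L1 L2).
Qed.

Lemma le_right_limit (f g : R -> R) (e : R) :
  (0 < e)%R -> ex_derive f 0%R -> ex_derive g 0%R ->
  (forall x, (0 < x < e)%R -> (f x <= g x)%R) -> (f 0 <= g 0)%R.
Proof.
intros He [df Hf] [dg Hg] H.
apply Rnot_lt_le; intros Hlt.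
pose proof (ex_derive_continuous f 0%R (ex_intro _ df Hf)) as Cf.
pose proof (ex_derive_continuous g 0%R (ex_intro _ dg Hg)) as Cg.
assert (Hp : (0 < (f 0 - g 0) / 2)%R) by lra.
destruct (Cf _ (locally_ball (f 0%R) (mkposreal _ Hp))) as [d1 H1].
destruct (Cg _ (locally_ball (g 0%R) (mkposreal _ Hp))) as [d2 H2].
set (x := (Rmin e (Rmin d1 d2) / 2)%R).
assert (Hx : (0 < x /\ x < e /\ x < d1 /\ x < d2)%R).
{ pose proof (Rmin_l e (Rmin d1 d2)); pose proof (Rmin_r e (Rmin d1 d2)).
  pose proof (Rmin_l d1 d2); pose proof (Rmin_r d1 d2).
  pose proof (Rmin_pos _ _ He (Rmin_pos _ _ (cond_pos d1) (cond_pos d2))); unfold x; lra. }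
assert (Hab : Rabs (x - 0) = x) by (rewrite Rminus_0_r; apply Rabs_pos_eq; lra).
specialize (H1 x); specialize (H2 x); specialize (H x ltac:(lra)).
unfold ball in H1, H2; simpl in H1, H2; unfold AbsRing_ball, abs, minus, plus, opp in H1, H2; simpl in H1, H2.
unfold Rminus in Hab; rewrite Hab in H1, H2.
specialize (H1 ltac:(lra)); specialize (H2 ltac:(lra)).
apply Rabs_def2 in H1; apply Rabs_def2 in H2; lra.
Qed.

Lemma exp_le_compat (x y : R) : (x <= y)%R -> (exp x <= exp y)%R.
Proof. intros [H | ->]; [now apply Rlt_le, exp_increasing|apply Rle_refl]. Qed.

(** The function [G = |w| e^(eps |y|^2) / |y|^(n - eps)] replaces [|w / y^n|]. One [eps] does two
    things: the weakened exponent makes [G] tend to 0 at the origin, so that no removable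
    singularity is needed, and the exponential factor makes [ln G] strictly subharmonic, so that [G]
    has no interior maximum where it is positive. *)
Lemma schwarz_power_log (w Q : C -> C) (r rho eps K d0 : R) (n : nat) (z : C) :
  (0 < rho < r)%R -> (0 < eps)%R -> (0 < d0)%R ->
  (forall y, (Cmod y < r)%R -> (Cmod (w y) <= 1)%R) ->
  (forall y, (Cmod y < r)%R -> Ccontinuous w y) ->
  (forall y, (Cmod y < r)%R -> w y <> 0 ->
     is_Cderive w y (w y * Q y) /\ exists q, is_Cderive Q y q) ->
  (forall y, (Cmod y < d0)%R -> (Cmod (w y) <= K * Cmod y ^ n)%R) ->
  z <> 0 -> (Cmod z <= rho)%R ->
  (Cmod (w z) * exp (eps * Cmod z ^ 2 - (INR n - eps) * ln (Cmod z)) <=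
   exp (eps * rho ^ 2 - (INR n - eps) * ln rho))%R.
Proof.
intros Hrho He Hd0 Hw1 Hwc Hwd Hw0 Hz0 Hz.
set (G := fun y : C => (Cmod (w y) * exp (eps * Cmod y ^ 2 - (INR n - eps) * ln (Cmod y)))%R).
apply Rnot_lt_le; intros Hlt; change (exp (eps * rho ^ 2 - (INR n - eps) * ln rho) < G z)%R in Hlt.
assert (HGz : (0 < G z)%R) by (eapply Rlt_trans; [apply exp_pos|exact Hlt]).
assert (Hzp : (0 < Cmod z)%R) by now apply Cmod_gt_0.
assert (HGpos : forall y, (0 < G y)%R -> w y <> 0).
{ intros y Hy H0; unfold G in Hy; rewrite H0, Cmod_0 in Hy; lra. }
(* Near 0, G y <= K |y|^eps e^(eps |y|^2) tends to 0. *)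
assert (Hsmall : exists r0 : R, (0 < r0 < Cmod z)%R /\
  forall y, (0 < Cmod y <= r0)%R -> (G y < G z)%R).
{ set (B := (exp (eps * rho ^ 2) * (Rabs K + 1))%R).
  assert (HB : (0 < B)%R).
  { apply Rmult_lt_0_compat; [apply exp_pos|pose proof (Rabs_pos K); lra]. }
  (* The solution of [B * r1 ^ eps = G z]; below this radius the bound on [G] is smaller than
     [G z]. *)
  set (r1 := exp (ln (G z / B) / eps)).
  assert (Hr1 : (0 < r1)%R) by apply exp_pos.
  set (r0 := (Rmin (Rmin (d0 / 2) (Cmod z / 2)) (r1 / 2))%R).
  assert (Hr0 : (0 < r0 /\ r0 < d0 /\ r0 < Cmod z /\ r0 < r1)%R).
  { pose proof (Rmin_l (Rmin (d0 / 2) (Cmod z / 2)) (r1 / 2)).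
    pose proof (Rmin_r (Rmin (d0 / 2) (Cmod z / 2)) (r1 / 2)).
    pose proof (Rmin_l (d0 / 2) (Cmod z / 2)); pose proof (Rmin_r (d0 / 2) (Cmod z / 2)).
    assert (0 < r0)%R by (repeat apply Rmin_pos; lra).
    unfold r0 in *; lra. }
  exists r0; split; [lra|]; intros y Hy.
  apply Rle_lt_trans with (B * exp (eps * ln (Cmod y)))%R.
  - unfold G, B.
    assert (Hyn : (Cmod y ^ n = exp (INR n * ln (Cmod y)))%R).
    { rewrite <- Rpower_pow by lra; reflexivity. }
    replace (eps * Cmod y ^ 2 - (INR n - eps) * ln (Cmod y))%R
      with (eps * Cmod y ^ 2 + eps * ln (Cmod y) + - (INR n * ln (Cmod y)))%R by ring.
    rewrite !exp_plus, exp_Ropp, <- Hyn.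
    pose proof (Hw0 y ltac:(lra)) as H0.
    assert (Hpn : (0 < Cmod y ^ n)%R) by (apply pow_lt; lra).
    assert (HK : (Cmod (w y) * / Cmod y ^ n <= Rabs K + 1)%R).
    { apply (Rle_div_l _ _ _ Hpn); eapply Rle_trans; [exact H0|].
      apply Rmult_le_compat_r; [lra|]; pose proof (Rle_abs K); lra. }
    assert (Hex : (exp (eps * Cmod y ^ 2) <= exp (eps * rho ^ 2))%R).
    { apply exp_le_compat; apply Rmult_le_compat_l; [lra|]. apply pow_incr; lra. }
    replace (Cmod (w y) * (exp (eps * Cmod y ^ 2) * exp (eps * ln (Cmod y)) * / Cmod y ^ n))%R
      with (exp (eps * Cmod y ^ 2) * (Cmod (w y) * / Cmod y ^ n) * exp (eps * ln (Cmod y)))%R by ring.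
    apply Rmult_le_compat_r; [apply Rlt_le, exp_pos|].
    apply Rmult_le_compat; [apply Rlt_le, exp_pos| |exact Hex|exact HK].
    apply Rmult_le_pos; [apply Cmod_ge_0|apply Rlt_le, Rinv_0_lt_compat, Hpn].
  - replace (G z) with (B * (G z / B))%R by (field; lra).
    apply Rmult_lt_compat_l; [exact HB|].
    rewrite <- (exp_ln (G z / B)) by (apply Rdiv_lt_0_compat; lra).
    apply exp_increasing.
    replace (ln (G z / B)) with (eps * ln r1)%R by (unfold r1; rewrite ln_exp; field; lra).
    apply Rmult_lt_compat_l; [exact He|]. apply ln_increasing; lra. }
destruct Hsmall as [r0 [Hr0 Hsmall]].
set (A := fun y : C => (r0 <= Cmod y <= rho)%R).
assert (HGcont : forall y, A y -> continuous (T := C_UniformSpace) (U := R_UniformSpace) G y).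
{ intros y Hy.
  assert (Hid : Ccontinuous (fun x => x) y) by exact (is_Cderive_continuous _ _ _ (is_Cderive_id y)).
  apply (continuous_mult (U := C_UniformSpace) (K := R_AbsRing) (fun x : C => Cmod (w x))).
  - apply Ccontinuous_Cmod, Hwc; unfold A in Hy; lra.
  - apply (continuous_comp (U := C_UniformSpace) Cmod (fun s : R => exp (eps * s ^ 2 - (INR n - eps) * ln s))).
    + exact (Ccontinuous_Cmod _ _ Hid).
    + apply (ex_derive_continuous (fun s : R => exp (eps * s ^ 2 - (INR n - eps) * ln s))).
      auto_derive; unfold A in Hy; lra. }
assert (HGB : exists B, forall y, A y -> (G y <= B)%R).
{ exists (exp (eps * rho ^ 2 + (INR n + eps) * (Rabs (ln r0) + Rabs (ln rho))))%R; intros y Hy; unfold A in Hy.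
  unfold G; rewrite <- (Rmult_1_l (exp (eps * rho ^ 2 + _))).
  apply Rmult_le_compat; [apply Cmod_ge_0|apply Rlt_le, exp_pos|apply Hw1; lra|].
  apply exp_le_compat.
  assert (Cmod y ^ 2 <= rho ^ 2)%R by (apply pow_incr; lra).
  pose proof (pos_INR n).
  assert (L1 : (ln r0 <= ln (Cmod y))%R) by (apply ln_le; lra).
  assert (L2 : (ln (Cmod y) <= ln rho)%R) by (apply ln_le; lra).
  pose proof (Rle_abs (ln rho)); pose proof (Rle_abs (- ln r0)); rewrite Rabs_Ropp in *.
  pose proof (Rabs_pos (ln r0)); pose proof (Rabs_pos (ln rho)).
  assert (- (INR n - eps) * ln (Cmod y) <= (INR n + eps) * (Rabs (ln r0) + Rabs (ln rho)))%R by nra.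
  nra. }
destruct HGB as [B HGB].
destruct (compact_max A G rho B) as [y [Hy Hmax]].
- exists z; unfold A; lra.
- intros y Hy; apply Hy.
- exact HGB.
- intros y Hy; unfold A in *.
  destruct (Rlt_le_dec (Cmod y) r0) as [H|H].
  + exists (r0 - Cmod y)%R; split; [lra|]; intros x Hx.
    pose proof (Cmod_triangle_minus x y); lra.
  + exists (Cmod y - rho)%R; split; [lra|]; intros x Hx.
    pose proof (Cmod_triangle_minus y x) as T; rewrite (Cmod_minus_sym y) in T; lra.
- intros y Hy e He'; pose proof (HGcont y Hy) as HC; rewrite continuous_CRE in HC.
  destruct (HC e He') as [d [Hd Hx]]; exists d; split; [exact Hd|]; intros x _ Hxy.
  specialize (Hx x Hxy); apply Rabs_def2 in Hx; lra.
- assert (HzA : A z) by (unfold A; lra).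
  pose proof (Hmax z HzA) as Hzy.
  (* A maximum point on the inner circle would have a value below [G z], and one on the outer
     circle, where [|w| <= 1], a value at most the claimed bound. So it is interior. *)
  assert (Hy1 : (r0 < Cmod y)%R).
  { apply Rnot_le_lt; intros H; specialize (Hsmall y ltac:(unfold A in Hy; lra)); lra. }
  assert (Hy2 : (Cmod y < rho)%R).
  { apply Rnot_le_lt; intros H.
    assert (Heq : Cmod y = rho) by (unfold A in Hy; lra).
    pose proof (Hw1 y ltac:(lra)) as H1.
    assert (G y <= exp (eps * rho ^ 2 - (INR n - eps) * ln rho))%R; [|lra].
    unfold G; rewrite Heq.
    rewrite <- (Rmult_1_l (exp (eps * rho ^ 2 - (INR n - eps) * ln rho))) at 2.
    apply Rmult_le_compat_r; [apply Rlt_le, exp_pos|exact H1]. }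
  assert (Hwy : w y <> 0) by (apply HGpos; lra).
  destruct (Hwd y ltac:(lra) Hwy) as [_ [q Hq]].
  destruct (Hwc y ltac:(lra) (Cmod (w y)) (proj1 (Cmod_gt_0 _) Hwy)) as [d [Hd Hdy]].
  set (delta := Rmin d (Rmin (Cmod y - r0) (rho - Cmod y))).
  assert (Hdelta : (0 < delta /\ delta <= d /\ delta <= Cmod y - r0 /\ delta <= rho - Cmod y)%R).
  { pose proof (Rmin_l d (Rmin (Cmod y - r0) (rho - Cmod y))).
    pose proof (Rmin_r d (Rmin (Cmod y - r0) (rho - Cmod y))).
    pose proof (Rmin_l (Cmod y - r0) (rho - Cmod y)); pose proof (Rmin_r (Cmod y - r0) (rho - Cmod y)).
    assert (0 < delta)%R by (repeat apply Rmin_pos; lra); unfold delta in *; lra. }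
  assert (Hnear : forall x, (Cmod (x - y) < delta)%R -> (r0 < Cmod x < rho)%R /\ w x <> 0).
  { intros x Hx; split.
    - pose proof (Cmod_triangle_minus x y).
      pose proof (Cmod_triangle_minus y x) as T; rewrite (Cmod_minus_sym y) in T; lra.
    - intros H0; specialize (Hdy x ltac:(lra)).
      rewrite H0 in Hdy; replace (0 - w y) with (- w y) in Hdy by ring; rewrite Cmod_opp in Hdy; lra. }
  assert (HlnG : forall x, (0 < Cmod x)%R -> w x <> 0 ->
    (ln (G x) = ln (Cmod (w x)) + eps * Cmod x ^ 2 - (INR n - eps) * ln (Cmod x))%R).
  { intros x Hx Hx'; unfold G; rewrite ln_mult, ln_exp; [ring|now apply Cmod_gt_0|apply exp_pos]. }
  apply (no_local_max_log w Q y q (INR n - eps) eps delta He ltac:(lra)); [|exact Hq|].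
  + intros x Hx; destruct (Hnear x Hx) as [Hx1 Hx2].
    split; [exact Hx2|]; split; [apply Cmod_gt_0; lra|].
    apply Hwd; [lra|exact Hx2].
  + intros x Hx; destruct (Hnear x Hx) as [Hx1 Hx2].
    rewrite <- !HlnG; try assumption; try lra.
    apply ln_le.
    * unfold G; apply Rmult_lt_0_compat; [now apply Cmod_gt_0|apply exp_pos].
    * apply Hmax; unfold A; lra.
Qed.

Lemma schwarz_power (w Q : C -> C) (r : R) (n : nat) :
  (0 < r)%R ->
  (forall y, (Cmod y < r)%R -> (Cmod (w y) <= 1)%R) ->
  (forall y, (Cmod y < r)%R -> Ccontinuous w y) ->
  (forall y, (Cmod y < r)%R -> w y <> 0 ->
     is_Cderive w y (w y * Q y) /\ exists q, is_Cderive Q y q) ->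
  (exists K d0 : R, (0 < d0)%R /\
     forall y, (Cmod y < d0)%R -> (Cmod (w y) <= K * Cmod y ^ n)%R) ->
  forall z, (Cmod z < r)%R -> (Cmod (w z) <= (Cmod z / r) ^ n)%R.
Proof.
intros Hr Hw1 Hwc Hwd [K [d0 [Hd0 Hw0]]] z Hz.
destruct (Ceq_dec z 0) as [->|Hz0].
{ destruct n as [|n]; [apply Hw1, Hz|].
  specialize (Hw0 0); rewrite Cmod_0 in *; specialize (Hw0 Hd0).
  unfold Rdiv; rewrite Rmult_0_l; rewrite pow_i in * by lia; lra. }
assert (Hzp : (0 < Cmod z)%R) by now apply Cmod_gt_0.
assert (H : (Cmod (w z) * exp (0 * Cmod z ^ 2 - (INR n - 0) * ln (Cmod z)) <=
   exp (0 * (r - 0) ^ 2 - (INR n - 0) * ln (r - 0)))%R).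
(* The parameter [e] is both the perturbation [eps] and the gap [r - rho]; letting it decrease to 0
   removes both at once. *)
{ apply (le_right_limit
    (fun e => Cmod (w z) * exp (e * Cmod z ^ 2 - (INR n - e) * ln (Cmod z)))%R
    (fun e => exp (e * (r - e) ^ 2 - (INR n - e) * ln (r - e)))%R (r - Cmod z)); [lra| | |].
  - auto_derive; trivial.
  - auto_derive; lra.
  - intros e He; apply (schwarz_power_log w Q r (r - e) e K d0 n z); auto; lra. }
rewrite !Rmult_0_l, !Rminus_0_r, !Rminus_0_l, !exp_Ropp in H.
change (exp (INR n * ln (Cmod z))) with (Rpower (Cmod z) (INR n)) in H.
change (exp (INR n * ln r)) with (Rpower r (INR n)) in H.
rewrite !Rpower_pow in H by assumption.
assert (0 < Cmod z ^ n)%R by now apply pow_lt.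
assert (0 < r ^ n)%R by now apply pow_lt.
unfold Rdiv; rewrite Rpow_mult_distr, pow_inv.
apply (Rle_div_l _ _ _ H0) in H; lra.
Qed.

(** * Complex power series *)

Definition is_Cseries (a : nat -> C) (l : C) : Prop := is_series (V := C_NormedModule) a l.

Lemma Cpow_pow_n (z : C) (k : nat) : pow_n (K := C_AbsRing) z k = z ^ k.
Proof. induction k as [|k IH]; [reflexivity|]. rewrite Cpow_S, <- IH; reflexivity. Qed.

Lemma is_pseries_Cseries (a : nat -> C) (z l : C) :
  is_pseries (V := C_NormedModule) a z l <-> is_Cseries (fun k => a k * z ^ k) l.
Proof.
assert (E : forall k, scal (V := C_NormedModule) (pow_n (K := C_AbsRing) z k) (a k) = a k * z ^ k).
{ intros k; exact (eq_trans (f_equal (fun p => p * a k) (Cpow_pow_n z k)) (Cmult_comm _ _)). }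
split; apply is_series_ext; intros k; [apply E|symmetry; apply E].
Qed.

Lemma is_Cseries_Cmod_le (t : nat -> C) (b : nat -> R) (l : C) (S : R) :
  (forall k, (Cmod (t k) <= b k)%R) -> is_Cseries t l -> is_series b S -> (Cmod l <= S)%R.
Proof.
intros Htb Ht Hb.
assert (H1 : is_lim_seq (fun n => norm (sum_n (G := C_NormedModule) t n)) (norm (V := C_NormedModule) l)).
{ refine (filterlim_comp _ _ _ _ _ _ _ _ Ht _). apply filterlim_norm. }
assert (H2 : is_lim_seq (fun n => sum_n b n) S) by exact Hb.
refine (is_lim_seq_le _ _ (Finite _) (Finite S) _ H1 H2).
intros n; eapply Rle_trans; [apply norm_sum_n_m|].
unfold sum_n; apply sum_n_m_le; exact Htb.
Qed.

Lemma is_Cseries_bounded (t : nat -> C) (l : C) :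
  is_Cseries t l -> exists M : R, forall k, (Cmod (t k) <= M)%R.
Proof.
intros Ht.
destruct (filterlim_bounded (V := C_NormedModule) (sum_n t) (ex_intro _ l Ht)) as [M HM].
change (forall n, (Cmod (sum_n (G := C_NormedModule) t n) <= M)%R) in HM.
exists (2 * M)%R; intros [|k].
- specialize (HM 0%nat); rewrite sum_O in HM; pose proof (Cmod_ge_0 (t 0%nat)); lra.
- pose proof (HM k) as H0; pose proof (HM (S k)) as H1; rewrite sum_Sn in H1.
  pose proof (Cmod_triangle_minus (t (S k)) (- sum_n (G := C_NormedModule) t k)) as T.
  rewrite Cmod_opp in T.
  change (plus (sum_n (G := C_NormedModule) t k) (t (S k))) with (sum_n (G := C_NormedModule) t k + t (S k)) in H1.
  replace (t (S k) - - sum_n (G := C_NormedModule) t k)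
    with (sum_n (G := C_NormedModule) t k + t (S k)) in T by ring.
  lra.
Qed.

Definition converges_on_disc (a : nat -> C) (g : C -> C) : Prop :=
  forall z, unit_disc z -> is_Cseries (fun k => a k * z ^ k) (g z).

Definition Cderive_coef (a : nat -> C) (k : nat) : C := INR (S k) * a (S k).

(** Convergence at the midpoint of [s] and 1 bounds the terms there. Passing to the moduli of the
    coefficients lets the real theory of the radius of convergence, which is unchanged by
    derivation, handle the derived series. *)
Lemma CV_radius_disc (a : nat -> C) (g : C -> C) (s : R) :
  converges_on_disc a g -> (0 <= s < 1)%R -> Rbar_lt (Rabs s) (CV_radius (fun k => Cmod (a k))).
Proof.
intros Ha Hs.
set (rho := ((1 + s) / 2)%R).
assert (Hrho : (s < rho < 1)%R) by (unfold rho; lra).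
apply Rbar_lt_le_trans with rho.
{ simpl; rewrite Rabs_pos_eq; lra. }
destruct (is_Cseries_bounded _ _ (Ha (RtoC rho) ltac:(unfold unit_disc; rewrite Cmod_R, Rabs_pos_eq; lra))) as [M HM].
apply (CV_radius_bounded (fun k => Cmod (a k))).
exists M; intros k; specialize (HM k).
rewrite Cmod_mult, Cmod_pow, Cmod_R, Rabs_pos_eq in HM by lra.
rewrite Rabs_pos_eq; [exact HM|].
apply Rmult_le_pos; [apply Cmod_ge_0|apply pow_le; lra].
Qed.

Lemma Cmod_derive_coef (a : nat -> C) (k : nat) :
  Cmod (Cderive_coef a k) = PS_derive (fun k => Cmod (a k)) k.
Proof.
unfold Cderive_coef, PS_derive; rewrite Cmod_mult, Cmod_R, Rabs_pos_eq; [reflexivity|apply pos_INR].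
Qed.

Lemma ex_series_derive_coef (a : nat -> C) (g : C -> C) (s : R) :
  converges_on_disc a g -> (0 <= s < 1)%R ->
  ex_series (fun k => (Cmod (Cderive_coef a k) * s ^ k)%R).
Proof.
intros Ha Hs.
pose proof (CV_radius_disc a g s Ha Hs) as HR; rewrite <- CV_radius_derive in HR.
refine (ex_series_ext _ _ _ (CV_disk_inside _ _ HR)); intros k.
rewrite Cmod_derive_coef; apply Rabs_pos_eq.
rewrite <- Cmod_derive_coef; apply Rmult_le_pos; [apply Cmod_ge_0|apply pow_le; lra].
Qed.

Lemma ex_series_derive2_coef (a : nat -> C) (g : C -> C) (s : R) :
  converges_on_disc a g -> (0 <= s < 1)%R ->
  ex_series (fun k => (INR (k + 2) * INR (k + 1) * Cmod (a (k + 2)%nat) * s ^ k)%R).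
Proof.
intros Ha Hs.
pose proof (CV_radius_disc a g s Ha Hs) as HR; rewrite <- CV_radius_derive, <- CV_radius_derive in HR.
refine (ex_series_ext _ _ _ (CV_disk_inside _ _ HR)); intros k; unfold PS_derive.
replace (S (S k)) with (k + 2)%nat by lia; replace (S k) with (k + 1)%nat by lia.
rewrite Rabs_pos_eq; [match goal with |- ?a = ?b => change (@eq R a b) end; ring|].
repeat apply Rmult_le_pos; try apply pos_INR; try apply Cmod_ge_0; apply pow_le; lra.
Qed.

(** If [R_m] denotes the first-order Taylor remainder of the [m]-th power, then
    [R_(m+1) = y R_m + m (y - z)^2 z^(m-1)]. Omitting the usual factor 1/2 leaves slack for the
    induction, and the bound has the coefficients of the second derived series, which is
    summable. *)
Lemma Cpow_taylor_bound (y z : C) (s : R) (k : nat) :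
  (Cmod y <= s)%R -> (Cmod z <= s)%R ->
  (Cmod (y ^ (k + 2) - z ^ (k + 2) - (y - z) * (INR (k + 2) * z ^ (k + 1)))
   <= INR (k + 2) * INR (k + 1) * s ^ k * Cmod (y - z) ^ 2)%R.
Proof.
intros Hy Hz; pose proof (Cmod_ge_0 y) as Hy0; pose proof (Cmod_ge_0 z) as Hz0.
induction k as [|k IH].
- replace (y ^ (0 + 2) - z ^ (0 + 2) - (y - z) * (INR (0 + 2) * z ^ (0 + 1)))
    with ((y - z) * (y - z)) by (simpl; rewrite RtoC_plus; ring).
  rewrite Cmod_mult; simpl; pose proof (Cmod_ge_0 (y - z)); nra.
- replace (S k + 2)%nat with (S (k + 2)) by lia; replace (S k + 1)%nat with (S (k + 1)) by lia.
  replace (k + 2)%nat with (S (k + 1)) in * by lia.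
  rewrite !Cpow_S in *; rewrite (S_INR (S (k + 1))), RtoC_plus.
  assert (Hp : (Cmod (z ^ (k + 1)) <= s ^ (k + 1))%R) by (rewrite Cmod_pow; apply pow_incr; lra).
  set (X := y * y ^ (k + 1) - z * z ^ (k + 1) - (y - z) * (INR (S (k + 1)) * z ^ (k + 1))) in *.
  replace (y * (y * y ^ (k + 1)) - z * (z * z ^ (k + 1)) - (y - z) * ((INR (S (k + 1)) + 1) * (z * z ^ (k + 1))))
    with (y * X + (y - z) * (y - z) * (INR (S (k + 1)) * z ^ (k + 1))) by (unfold X; ring).
  eapply Rle_trans; [apply Cmod_triangle|].
  rewrite !Cmod_mult, Cmod_R, (Rabs_pos_eq (INR _)) by apply pos_INR.
  assert (HX : (Cmod y * Cmod X <= s * (INR (S (k + 1)) * INR (k + 1) * s ^ k * Cmod (y - z) ^ 2))%R).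
  { apply Rmult_le_compat; try assumption; apply Cmod_ge_0. }
  set (m := INR (S (k + 1))) in *.
  assert (Hm : m = (INR (k + 1) + 1)%R) by apply S_INR.
  pose proof (pos_INR (k + 1)) as Hk.
  pose proof (Cmod_ge_0 (y - z)) as Hd.
  assert (HY : (Cmod (y - z) * Cmod (y - z) * (m * Cmod (z ^ (k + 1))) <= Cmod (y - z) ^ 2 * (m * s ^ (k + 1)))%R).
  { simpl (_ ^ 2)%R; rewrite Rmult_1_r; apply Rmult_le_compat_l; [nra|]; apply Rmult_le_compat_l; lra. }
  eapply Rle_trans; [apply Rplus_le_compat; [exact HX|exact HY]|].
  replace (s ^ S k)%R with (s * s ^ k)%R by reflexivity.
  replace (s ^ (k + 1))%R with (s * s ^ k)%R by (rewrite pow_add; ring).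
  assert (Hss : (0 <= s * s ^ k)%R) by (apply Rmult_le_pos; [lra|apply pow_le; lra]).
  assert (HP : (0 <= s * s ^ k * Cmod (y - z) ^ 2)%R) by (apply Rmult_le_pos; [exact Hss|apply pow2_ge_0]).
  set (W := (s * s ^ k * Cmod (y - z) ^ 2)%R) in *.
  replace (s * (m * INR (k + 1) * s ^ k * Cmod (y - z) ^ 2) + Cmod (y - z) ^ 2 * (m * (s * s ^ k)))%R
    with (m * (INR (k + 1) + 1) * W)%R by (unfold W; ring).
  replace ((m + 1) * m * (s * s ^ k) * Cmod (y - z) ^ 2)%R with ((m + 1) * m * W)%R by (unfold W; ring).
  rewrite Hm; nra.
Qed.

Lemma converges_on_disc_derive (a : nat -> C) (g : C -> C) :
  converges_on_disc a g ->
  exists g1, converges_on_disc (Cderive_coef a) g1 /\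
    forall z, unit_disc z -> is_Cderive g z (g1 z).
Proof.
intros Ha.
assert (Hex : forall z, exists l, unit_disc z -> is_Cseries (fun k => Cderive_coef a k * z ^ k) l).
{ intros z; destruct (classic (unit_disc z)) as [Hz|Hz]; [|exists 0; contradiction].
  destruct (ex_series_le (V := C_CompleteNormedModule) (fun k => Cderive_coef a k * z ^ k)
    (fun k => Cmod (Cderive_coef a k) * Cmod z ^ k)%R) as [l Hl].
  - intros k; apply Req_le; exact (eq_trans (Cmod_mult _ _) (f_equal _ (Cmod_pow z k))).
  - apply (ex_series_derive_coef a g); [exact Ha|]; split; [apply Cmod_ge_0|exact Hz].
  - exists l; intros _; exact Hl. }
set (g1 := fun z => proj1_sig (constructive_indefinite_description _ (Hex z))).
assert (Hg1 : converges_on_disc (Cderive_coef a) g1).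
{ intros z Hz; unfold g1; destruct (constructive_indefinite_description _ (Hex z)) as [l Hl]; exact (Hl Hz). }
clearbody g1; exists g1; split; [exact Hg1|].
intros z Hz; apply is_CderiveE; intros eps He.
pose proof (Cmod_ge_0 z) as Hz0; unfold unit_disc in Hz.
set (s := ((1 + Cmod z) / 2)%R).
assert (Hs : (Cmod z < s < 1)%R) by (unfold s; lra).
destruct (ex_series_derive2_coef a g s Ha ltac:(lra)) as [B HB].
assert (HB0 : (0 <= B)%R).
{ refine (Rle_trans _ _ _ (Cmod_ge_0 0) (is_Cseries_Cmod_le (fun _ => 0) _ 0 B _ _ HB)).
  - intros k; rewrite Cmod_0; repeat apply Rmult_le_pos; try apply pos_INR; try apply Cmod_ge_0; apply pow_le; lra.
  - unfold is_Cseries, is_series; eapply filterlim_ext; [|apply filterlim_const].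
    intros n; symmetry; induction n as [|n IH]; [apply sum_O|].
    rewrite sum_Sn, IH; exact (Cplus_0_r 0). }
exists (Rmin (s - Cmod z) (eps / (B + 1))); split.
{ apply Rmin_pos; [lra|apply Rdiv_lt_0_compat; lra]. }
intros y Hy.
assert (Hy1 : (Cmod (y - z) < s - Cmod z)%R) by (eapply Rlt_le_trans; [exact Hy|apply Rmin_l]).
assert (Hy2 : (Cmod (y - z) < eps / (B + 1))%R) by (eapply Rlt_le_trans; [exact Hy|apply Rmin_r]).
apply Rlt_div_r in Hy2; [|lra].
assert (Hys : (Cmod y < s)%R) by (pose proof (Cmod_triangle_minus y z); lra).
(* The Taylor remainder of the [k]-th term. At [k = 0] the truncated exponent [k - 1] is harmless
   because [INR k] vanishes. *)
set (t := fun k => a k * y ^ k - a k * z ^ k - (y - z) * (INR k * a k * z ^ (k - 1))).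
assert (Ht : is_Cseries t (g y - g z - (y - z) * g1 z)).
{ assert (H1 : is_Cseries (fun k => INR k * a k * z ^ (k - 1)) (g1 z)).
  { apply is_series_decr_1.
    refine (eq_ind (g1 z) (fun l => is_series _ l) _ _ _).
    - refine (is_series_ext _ _ _ _ (Hg1 z Hz)); intros k; unfold Cderive_coef.
      replace (S k - 1)%nat with k by lia; reflexivity.
    - change (g1 z = g1 z + - (INR 0 * a 0%nat * z ^ (0 - 1))); simpl; ring. }
  pose proof (is_series_minus _ _ _ _ (Ha y ltac:(unfold unit_disc; lra)) (Ha z Hz)) as H2.
  exact (is_series_minus _ _ _ _ H2 (is_series_scal (V := C_NormedModule) (y - z) _ _ H1)). }
(* The remainders of the constant and linear terms are 0; from index 2 on, [b] is the shifted second
   derived series, so the total remainder is at most [B |y - z|^2]. *)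
set (b := fun k => match k with S (S j) =>
   (Cmod (y - z) ^ 2 * (INR (j + 2) * INR (j + 1) * Cmod (a (j + 2)%nat) * s ^ j))%R | _ => 0%R end).
assert (Hb : is_series b (Cmod (y - z) ^ 2 * B)%R).
{ apply is_series_decr_1, is_series_decr_1.
  refine (eq_ind (Cmod (y - z) ^ 2 * B)%R (fun l => is_series _ l) _ _ _).
  - exact (is_series_scal (V := R_NormedModule) (Cmod (y - z) ^ 2)%R _ _ HB).
  - unfold b, plus, opp; simpl; ring. }
assert (Htb : forall k, (Cmod (t k) <= b k)%R).
{ intros [|[|j]]; unfold t, b.
  - apply Req_le; rewrite <- Cmod_0; f_equal; simpl; ring.
  - apply Req_le; rewrite <- Cmod_0; f_equal; simpl; ring.
  - replace (S (S j)) with (j + 2)%nat by lia; replace (j + 2 - 1)%nat with (j + 1)%nat by lia.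
    replace (a (j + 2)%nat * y ^ (j + 2) - a (j + 2)%nat * z ^ (j + 2) - (y - z) * (INR (j + 2) * a (j + 2)%nat * z ^ (j + 1)))
      with (a (j + 2)%nat * (y ^ (j + 2) - z ^ (j + 2) - (y - z) * (INR (j + 2) * z ^ (j + 1)))) by ring.
    rewrite Cmod_mult.
    pose proof (Cpow_taylor_bound y z s j ltac:(lra) ltac:(lra)) as T.
    pose proof (Cmod_ge_0 (a (j + 2)%nat)) as Hpos.
    eapply Rle_trans; [apply Rmult_le_compat_l; [exact Hpos|exact T]|].
    apply Req_le; ring. }
pose proof (is_Cseries_Cmod_le t b _ _ Htb Ht Hb) as H.
eapply Rle_trans; [exact H|].
pose proof (Cmod_ge_0 (y - z)); simpl; nra.
Qed.

(** The series of [g1] starts at [z^(n-1)]. For [|z| <= 1/2] and [k >= n - 1],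
    [|z|^k <= |z|^(n-1) (1/2)^(k-n+1)], which explains the factor [2 ^ (n - 1)]. Dividing [z * g1 z]
    by [g z] later gives [p z - 1]. *)
Lemma derive_coef_vanishing_bound (a : nat -> C) (g g1 : C -> C) (n : nat) :
  (0 < n)%nat -> converges_on_disc a g -> converges_on_disc (Cderive_coef a) g1 ->
  (forall k, (0 < k < n)%nat -> a k = 0) ->
  exists K : R, forall z, (Cmod z <= / 2)%R -> (Cmod (z * g1 z) <= K * Cmod z ^ n)%R.
Proof.
intros Hn Ha Hg1 Han.
destruct (ex_series_derive_coef a g (/ 2) Ha ltac:(lra)) as [B HB].
exists (2 ^ (n - 1) * B)%R; intros z Hz; pose proof (Cmod_ge_0 z) as Hz0.
rewrite Cmod_mult.
replace (Cmod z ^ n)%R with (Cmod z * Cmod z ^ (n - 1))%R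
  by (replace n with (S (n - 1)) at 2 by lia; reflexivity).
assert (H : (Cmod (g1 z) <= Cmod z ^ (n - 1) * 2 ^ (n - 1) * B)%R).
{ refine (is_Cseries_Cmod_le _ _ _ _ _ (Hg1 z ltac:(unfold unit_disc; lra))
    (is_series_scal (V := R_NormedModule) (Cmod z ^ (n - 1) * 2 ^ (n - 1))%R _ _ HB)).
  intros k; change scal with Rmult; rewrite Cmod_mult, Cmod_pow.
  destruct (Nat.lt_ge_cases (S k) n) as [Hk|Hk].
  - unfold Cderive_coef; rewrite (Han (S k)) by lia.
    rewrite Cmult_0_r, Cmod_0; lra.
  - replace k with (n - 1 + (k - (n - 1)))%nat at 2 4 by lia.
    rewrite !pow_add, pow_inv.
    set (j := (k - (n - 1))%nat).
    assert (Hj : (Cmod z ^ j <= (/ 2) ^ j)%R) by (apply pow_incr; lra).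
    assert (H2 : (0 < 2 ^ (n - 1))%R) by (apply pow_lt; lra).
    replace (Cmod z ^ (n - 1) * 2 ^ (n - 1) * (Cmod (Cderive_coef a k) * (/ 2 ^ (n - 1) * (/ 2) ^ j)))%R
      with (Cmod (Cderive_coef a k) * (Cmod z ^ (n - 1) * (/ 2) ^ j))%R by (field; lra).
    apply Rmult_le_compat_l; [apply Cmod_ge_0|].
    apply Rmult_le_compat_l; [apply pow_le; lra|exact Hj]. }
nra.
Qed.

(** * The sector |arg w| < alpha pi / 2 *)

(** For [alpha <= 1] the sector is an intersection of two half-planes, so it can be written by
    linear inequalities, without an argument function. The vertex 0 is excluded by strictness, and
    [alpha = 1] gives the right half-plane. *)
Definition in_sector (alpha : R) (w : C) : Prop :=
  (cos (alpha * PI / 2) * Rabs (Im w) < sin (alpha * PI / 2) * Re w)%R.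

Lemma sector_sin_pos (alpha : R) : (0 < alpha <= 1)%R -> (0 < sin (alpha * PI / 2))%R.
Proof. intros Ha; pose proof PI_RGT_0; apply sin_gt_0; nra. Qed.

Lemma sector_cos_nonneg (alpha : R) : (0 < alpha <= 1)%R -> (0 <= cos (alpha * PI / 2))%R.
Proof. intros Ha; pose proof PI_RGT_0; apply cos_ge_0; nra. Qed.

Lemma in_sector_Re_pos (alpha : R) (w : C) :
  (0 < alpha <= 1)%R -> in_sector alpha w -> (0 < Re w)%R.
Proof.
intros Ha Hw; unfold in_sector in Hw.
pose proof (sector_sin_pos alpha Ha); pose proof (sector_cos_nonneg alpha Ha).
pose proof (Rabs_pos (Im w)); nra.
Qed.

Lemma in_sector_1 (alpha : R) : (0 < alpha <= 1)%R -> in_sector alpha 1.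
Proof.
intros Ha; pose proof (sector_sin_pos alpha Ha); unfold in_sector; simpl; rewrite Rabs_R0; lra.
Qed.

Lemma in_sector_open (alpha : R) (f : C -> C) (z : C) :
  Ccontinuous f z -> in_sector alpha (f z) ->
  exists delta : R, (0 < delta)%R /\
    forall y, (Cmod (y - z) < delta)%R -> in_sector alpha (f y).
Proof.
unfold in_sector; set (a := sin _); set (b := cos _); intros Hf Hz.
assert (Hab : (0 < Rabs a + Rabs b + 1)%R) by (pose proof (Rabs_pos a); pose proof (Rabs_pos b); lra).
set (e := ((a * Re (f z) - b * Rabs (Im (f z))) / (Rabs a + Rabs b + 1))%R).
assert (He : (0 < e)%R) by (apply Rdiv_lt_0_compat; lra).
destruct (Hf e He) as [d [Hd Hy]]; exists d; split; [exact Hd|]; intros y Hyd.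
specialize (Hy y Hyd).
assert (Hee : (e * (Rabs a + Rabs b + 1) = a * Re (f z) - b * Rabs (Im (f z)))%R) by (unfold e; field; lra).
pose proof (re_le_Cmod (f y - f z)) as H1; pose proof (Rabs_Im_le_Cmod (f y - f z)) as H2.
assert (H3 : (Rabs (a * (Re (f y) - Re (f z))) <= Rabs a * Cmod (f y - f z))%R).
{ rewrite Rabs_mult; apply Rmult_le_compat_l; [apply Rabs_pos|exact H1]. }
assert (H4 : (Rabs (b * (Rabs (Im (f y)) - Rabs (Im (f z)))) <= Rabs b * Cmod (f y - f z))%R).
{ rewrite Rabs_mult; apply Rmult_le_compat_l; [apply Rabs_pos|].
  eapply Rle_trans; [apply Rabs_triang_inv2|exact H2]. }
apply Rabs_le_between in H3; apply Rabs_le_between in H4.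
pose proof (Rabs_pos a); pose proof (Rabs_pos b); nra.
Qed.

Lemma Im_Clog_bound (w : C) : (Rabs (Im (Clog w)) < PI / 2)%R.
Proof.
change (Im (Clog w)) with (atan (Im w / Re w)).
pose proof (atan_bound (Im w / Re w)); apply Rabs_def1; lra.
Qed.

Lemma Clog_polar (w : C) : (0 < Re w)%R ->
  Re w = (exp (Re (Clog w)) * cos (Im (Clog w)))%R /\ Im w = (exp (Re (Clog w)) * sin (Im (Clog w)))%R.
Proof.
intros Hw; pose proof (Cexp_Clog w Hw) as H; unfold Cexp in H.
rewrite <- H at 1 4; split; reflexivity.
Qed.

(** In polar form, with [t] the argument, the defining inequality reads
    [sin (alpha pi / 2 - |t|) > 0], and this difference lies between [- pi / 2] and [pi / 2]. *)
Lemma in_sector_Im_Clog (alpha : R) (w : C) :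
  (0 < alpha <= 1)%R -> in_sector alpha w -> (Rabs (Im (Clog w)) < alpha * PI / 2)%R.
Proof.
intros Ha Hw; pose proof (in_sector_Re_pos alpha w Ha Hw) as Hre.
destruct (Clog_polar w Hre) as [H1 H2]; unfold in_sector in Hw; rewrite H1, H2 in Hw.
pose proof (Im_Clog_bound w) as Ht.
set (t := Im (Clog w)) in *; set (x := exp (Re (Clog w))) in *.
assert (Hx : (0 < x)%R) by apply exp_pos.
rewrite Rabs_mult, (Rabs_pos_eq x) in Hw by lra.
assert (Hs : Rabs (sin t) = sin (Rabs t)).
{ pose proof PI_RGT_0; apply Rabs_def2 in Ht; destruct (Rle_lt_dec 0 t).
  - rewrite !Rabs_pos_eq; try assumption; try reflexivity; apply sin_ge_0; lra.
  - rewrite !Rabs_left; try assumption; [now rewrite sin_neg|apply sin_lt_0_var; lra]. }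
assert (Hc : cos t = cos (Rabs t)).
{ unfold Rabs; destruct (Rcase_abs t); [now rewrite cos_neg|reflexivity]. }
rewrite Hs, Hc in Hw.
assert (Hpos : (0 < sin (alpha * PI / 2 - Rabs t))%R).
{ rewrite sin_minus; nra. }
apply Rnot_le_lt; intros Hle.
pose proof PI_RGT_0.
assert (sin (alpha * PI / 2 - Rabs t) <= 0)%R; [|lra].
replace (alpha * PI / 2 - Rabs t)%R with (- (Rabs t - alpha * PI / 2))%R by ring.
rewrite sin_neg; assert (0 <= sin (Rabs t - alpha * PI / 2))%R; [|lra].
apply sin_ge_0; nra.
Qed.

Definition sector_root (alpha : R) (y : C) : C := Cexp (Clog y / alpha).

(* The conformal map of the sector onto the disc, inverse of ((1+w)/(1-w))^alpha. *)
Definition sector_to_disc (alpha : R) (y : C) : C :=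
  (sector_root alpha y - 1) / (sector_root alpha y + 1).

Lemma RtoC_neq_0 (x : R) : x <> 0%R -> RtoC x <> 0.
Proof. intros H E; apply H; exact (f_equal Re E). Qed.

Lemma Re_Cdiv_R (z : C) (x : R) : x <> 0%R -> Re (z / x) = (Re z / x)%R.
Proof. intros Hx; unfold Cdiv; rewrite <- RtoC_inv by exact Hx; apply re_scal_r. Qed.

Lemma Im_Cdiv_R (z : C) (x : R) : x <> 0%R -> Im (z / x) = (Im z / x)%R.
Proof. intros Hx; unfold Cdiv; rewrite <- RtoC_inv by exact Hx; apply im_scal_r. Qed.

Lemma in_sector_Im_root (alpha : R) (y : C) :
  (0 < alpha <= 1)%R -> in_sector alpha y -> (Rabs (Im (Clog y / alpha)) < PI / 2)%R.
Proof.
intros Ha Hy; pose proof (in_sector_Im_Clog alpha y Ha Hy) as H.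
rewrite Im_Cdiv_R by lra; unfold Rdiv; rewrite Rabs_mult, Rabs_inv, (Rabs_pos_eq alpha) by lra.
apply (Rlt_div_l _ _ alpha); lra.
Qed.

Lemma sector_root_Re_pos (alpha : R) (y : C) :
  (0 < alpha <= 1)%R -> in_sector alpha y -> (0 < Re (sector_root alpha y))%R.
Proof.
intros Ha Hy; pose proof (in_sector_Im_root alpha y Ha Hy) as H.
apply Rabs_def2 in H; unfold sector_root, Cexp; simpl.
apply Rmult_lt_0_compat; [apply exp_pos|apply cos_gt_0; tauto].
Qed.

Lemma Cplus_1_neq_0 (v : C) : (0 < Re v)%R -> v + 1 <> 0.
Proof. intros H E; pose proof (f_equal Re E) as E'; simpl in E'; unfold Re in *; lra. Qed.

Lemma Cmod_lt_sq (x y : C) : (Cmod x ^ 2 < Cmod y ^ 2)%R -> (Cmod x < Cmod y)%R.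
Proof. intros H; pose proof (Cmod_ge_0 x); pose proof (Cmod_ge_0 y); nra. Qed.

Lemma sector_to_disc_lt_1 (alpha : R) (y : C) :
  (0 < alpha <= 1)%R -> in_sector alpha y -> (Cmod (sector_to_disc alpha y) < 1)%R.
Proof.
intros Ha Hy; pose proof (sector_root_Re_pos alpha y Ha Hy) as H; unfold sector_to_disc.
set (v := sector_root alpha y) in *; clearbody v.
pose proof (Cplus_1_neq_0 v H) as H1.
rewrite Cmod_div by exact H1.
apply (Rlt_div_l _ 1 _ (proj1 (Cmod_gt_0 _) H1)); rewrite Rmult_1_l.
apply Cmod_lt_sq; rewrite !Cmod2_alt; unfold Re, Im in *; simpl; nra.
Qed.

Lemma is_Cderive_sector_root (alpha : R) (y : C) :
  (0 < alpha)%R -> (0 < Re y)%R ->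
  is_Cderive (sector_root alpha) y (sector_root alpha y / (alpha * y)).
Proof.
intros Ha Hy.
assert (Hy0 : y <> 0) by now apply Cmod_gt_0, Cmod_gt_0_Re.
assert (Ha0 : RtoC alpha <> 0) by (apply RtoC_neq_0; lra).
eapply is_Cderive_eq.
- apply (is_Cderive_comp Cexp (fun x => Clog x / alpha)); [apply is_Cderive_Cexp|].
  apply is_Cderive_div; [exact Ha0|now apply is_Cderive_Clog|apply is_Cderive_const].
- cbv beta; unfold sector_root; field; auto.
Qed.

Lemma is_Cderive_sector_to_disc (alpha : R) (y : C) :
  (0 < alpha <= 1)%R -> in_sector alpha y ->
  is_Cderive (sector_to_disc alpha) y
    (2 * sector_root alpha y / (alpha * y * ((sector_root alpha y + 1) * (sector_root alpha y + 1)))).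
Proof.
intros Ha Hy; pose proof (in_sector_Re_pos alpha y Ha Hy) as Hre.
pose proof (Cplus_1_neq_0 _ (sector_root_Re_pos alpha y Ha Hy)) as H1.
pose proof (is_Cderive_sector_root alpha y (proj1 Ha) Hre) as HV.
assert (Hy0 : y <> 0) by now apply Cmod_gt_0, Cmod_gt_0_Re.
assert (Ha0 : RtoC alpha <> 0) by (apply RtoC_neq_0; lra).
eapply is_Cderive_eq.
- apply (is_Cderive_div (fun x => sector_root alpha x - 1) (fun x => sector_root alpha x + 1)); [exact H1| |].
  + apply is_Cderive_minus; [exact HV|apply is_Cderive_const].
  + apply is_Cderive_plus; [exact HV|apply is_Cderive_const].
- cbv beta; field; auto.
Qed.

Lemma sector_root_1 (alpha : R) : (0 < alpha)%R -> sector_root alpha 1 = 1.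
Proof.
intros Ha; unfold sector_root.
replace (Clog 1) with (RtoC 0).
2:{ unfold Clog; rewrite Cmod_1, ln_1; simpl; unfold Rdiv; rewrite Rmult_0_l, atan_0; reflexivity. }
replace (0 / alpha) with (RtoC 0) by (field; apply RtoC_neq_0; lra).
apply Cexp_0.
Qed.

Lemma sector_to_disc_1 (alpha : R) : (0 < alpha)%R -> sector_to_disc alpha 1 = 0.
Proof.
intros Ha; unfold sector_to_disc; rewrite sector_root_1 by exact Ha.
field; apply Cplus_1_neq_0; simpl; lra.
Qed.

(** Bridges the [acos]-based argument used by [Cpower] and the imaginary part of an exponent; roots
    of sector points have exponents in this strip. *)
Lemma Carg_Cexp (v : C) : (Rabs (Im v) < PI / 2)%R -> Carg (Cexp v) = Im v.
Proof.
intros Hv; apply Rabs_def2 in Hv; pose proof PI_RGT_0.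
pose proof (exp_pos (Re v)) as He.
unfold Carg; rewrite Cmod_Cexp.
replace (Re (Cexp v) / exp (Re v))%R with (cos (Im v)) by (unfold Cexp; simpl; field; lra).
replace (Im (Cexp v)) with (exp (Re v) * sin (Im v))%R by reflexivity.
destruct (Rle_lt_dec 0 (Im v)) as [H0|H0].
- assert (0 <= sin (Im v))%R by (apply sin_ge_0; lra).
  destruct Rle_dec as [_|Hn]; [apply acos_cos; lra|exfalso; apply Hn; nra].
- assert (sin (Im v) < 0)%R by (apply sin_lt_0_var; lra).
  destruct Rle_dec as [Hn|_]; [exfalso; nra|].
  rewrite <- cos_neg, acos_cos; lra.
Qed.

(** The Moebius factor is undone and leaves [y^(1/alpha)], which lies in the right half-plane, where
    the principal power inverts the root. This identity makes [sector_to_disc alpha (p z)] the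
    function that realizes the subordination. *)
Lemma Cpower_sector_to_disc (alpha : R) (y : C) :
  (0 < alpha <= 1)%R -> in_sector alpha y ->
  Cpower ((1 + sector_to_disc alpha y) / (1 - sector_to_disc alpha y)) alpha = y.
Proof.
intros Ha Hy.
pose proof (Cplus_1_neq_0 _ (sector_root_Re_pos alpha y Ha Hy)) as H1.
assert (Ha0 : RtoC alpha <> 0) by (apply RtoC_neq_0; lra).
replace ((1 + sector_to_disc alpha y) / (1 - sector_to_disc alpha y)) with (sector_root alpha y).
2:{ unfold sector_to_disc; field; split; [exact H1|].
    replace (sector_root alpha y + 1 - (sector_root alpha y - 1)) with (RtoC 2) by ring.
    apply RtoC_neq_0; lra. }
unfold Cpower, sector_root, Cln.
rewrite Carg_Cexp by now apply in_sector_Im_root.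
rewrite Cmod_Cexp, ln_exp.
replace (Re (Clog y / alpha), Im (Clog y / alpha)) with (Clog y / alpha) by apply surjective_pairing.
replace (alpha * (Clog y / alpha)) with (Clog y) by (field; exact Ha0).
apply Cexp_Clog; now apply (in_sector_Re_pos alpha).
Qed.

(* With [sector_root alpha y = e^v], [(y^(1/alpha) - 1)/(y^(1/alpha) + 1) = tanh (v/2)]
   and [|tanh (v/2)|^2 = (cosh (Re v) - cos (Im v)) / (cosh (Re v) + cos (Im v))]. *)
Lemma sector_to_disc_le (alpha : R) (y : C) (T : R) :
  (0 < alpha <= 1)%R -> in_sector alpha y -> (Cmod (sector_to_disc alpha y) <= T)%R ->
  let v := Clog y / alpha in
  ((1 - T ^ 2) * (exp (Re v) + exp (- Re v)) <= 2 * (1 + T ^ 2) * cos (Im v))%R.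
Proof.
intros Ha Hy HT v.
pose proof (Cplus_1_neq_0 _ (sector_root_Re_pos alpha y Ha Hy)) as H1.
unfold sector_to_disc in HT; rewrite Cmod_div in HT by exact H1.
apply (Rle_div_l _ _ _ (proj1 (Cmod_gt_0 _) H1)) in HT.
assert (H2 : (Cmod (sector_root alpha y - 1) ^ 2 <= T ^ 2 * Cmod (sector_root alpha y + 1) ^ 2)%R).
{ rewrite <- Rpow_mult_distr; apply pow_incr; split; [apply Cmod_ge_0|exact HT]. }
unfold sector_root in H2; fold v in H2; clearbody v; clear HT H1.
rewrite !Cmod2_alt in H2.
pose proof (exp_pos (Re v)) as He; pose proof (sin2_cos2 (Im v)) as Hsc; unfold Rsqr in Hsc.
rewrite exp_Ropp.
change (Re (Cexp v - 1)) with (exp (Re v) * cos (Im v) + - (1))%R in H2.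
change (Re (Cexp v + 1)) with (exp (Re v) * cos (Im v) + 1)%R in H2.
change (Im (Cexp v - 1)) with (exp (Re v) * sin (Im v) + - 0)%R in H2.
change (Im (Cexp v + 1)) with (exp (Re v) * sin (Im v) + 0)%R in H2.
set (e := exp (Re v)) in *; set (c := cos (Im v)) in *; set (s := sin (Im v)) in *.
apply Rmult_le_reg_l with e; [exact He|].
replace (e * ((1 - T ^ 2) * (e + / e)))%R with ((1 - T ^ 2) * (e * e + 1))%R by (field; lra).
assert (Hm : ((e * c + - (1)) ^ 2 + (e * s + - 0) ^ 2 = e * e - 2 * (e * c) + 1)%R).
{ transitivity (e * e * (s * s + c * c) - 2 * (e * c) + 1)%R; [ring|rewrite Hsc; ring]. }
assert (Hp : ((e * c + 1) ^ 2 + (e * s + 0) ^ 2 = e * e + 2 * (e * c) + 1)%R).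
{ transitivity (e * e * (s * s + c * c) + 2 * (e * c) + 1)%R; [ring|rewrite Hsc; ring]. }
rewrite Hm, Hp in H2; lra.
Qed.

(** * First contact with the boundary of the sector *)

Lemma Rabs_sqr_1 (s : R) : (s * s = 1)%R -> Rabs s = 1%R.
Proof.
intros Hs; pose proof (Rabs_pos s).
assert (Rabs s * Rabs s = 1)%R by (rewrite <- Rabs_mult, Hs; apply Rabs_R1); nra.
Qed.

Lemma cos_2atan (T : R) : cos (2 * atan T) = ((1 - T ^ 2) / (1 + T ^ 2))%R.
Proof.
pose proof (pow2_ge_0 T) as HT.
rewrite cos_2a_cos, cos_atan; unfold Rsqr.
assert (Hs : (0 < sqrt (1 + T * T))%R) by (apply sqrt_lt_R0; nra).
assert (Hss : (sqrt (1 + T * T) * sqrt (1 + T * T) = 1 + T * T)%R) by (apply sqrt_sqrt; nra).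
replace (1 + T ^ 2)%R with (sqrt (1 + T * T) * sqrt (1 + T * T))%R by (rewrite Hss; ring).
replace (1 - T ^ 2)%R with (2 - sqrt (1 + T * T) * sqrt (1 + T * T))%R by (rewrite Hss; ring).
field; lra.
Qed.

Lemma exp_sum_ge_2 (x : R) : (2 <= exp x + exp (- x))%R.
Proof.
rewrite exp_Ropp; pose proof (exp_pos x) as He.
apply Rmult_le_reg_l with (exp x); [exact He|].
replace (exp x * (exp x + / exp x))%R with (exp x * exp x + 1)%R by (field; lra).
pose proof (pow2_ge_0 (exp x - 1)); simpl in *; lra.
Qed.

(** With [x + i eta = Clog y / alpha], the bound [(1 - T^2) cosh x <= (1 + T^2) cos eta] is read
    twice. From [cosh x >= 1], [cos eta >= cos (2 atan T)]. From [cos eta <= 1] and [T^2 <= t],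
    [(1 - t) e^(-x) <= 4]; as [alpha <= 1], [e^(alpha x) >= e^x] when [x < 0]. *)
Lemma sector_bounds (alpha t T : R) (y : C) :
  (0 < alpha <= 1)%R -> in_sector alpha y -> (0 <= T)%R -> (T <= t < 1)%R ->
  (Cmod (sector_to_disc alpha y) <= T)%R ->
  (Rabs (Im (Clog y)) <= 2 * alpha * atan T)%R /\ ((1 - t) / 4 <= exp (Re (Clog y)))%R.
Proof.
intros Ha Hy HT0 HTt HT.
pose proof (sector_to_disc_le alpha y T Ha Hy HT) as H; cbv zeta in H.
pose proof (in_sector_Im_root alpha y Ha Hy) as Hroot.
rewrite Re_Cdiv_R, Im_Cdiv_R in * by lra.
set (x := (Re (Clog y) / alpha)%R) in *; set (eta := (Im (Clog y) / alpha)%R) in *.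
assert (HX : Re (Clog y) = (alpha * x)%R) by (unfold x; field; lra).
assert (HE : Im (Clog y) = (alpha * eta)%R) by (unfold eta; field; lra).
rewrite HX, HE; clearbody x eta; clear HX HE.
assert (HT2 : (0 <= T ^ 2 <= t)%R) by (simpl; nra).
pose proof (exp_sum_ge_2 x) as H2.
pose proof (COS_bound eta) as Hcos.
split.
- assert (Hc : (cos (2 * atan T) <= cos eta)%R).
  { rewrite cos_2atan; apply (Rle_div_l _ _ (1 + T ^ 2)); [lra|].
    assert (2 * (1 - T ^ 2) <= (1 - T ^ 2) * (exp x + exp (- x)))%R by nra. lra. }
  rewrite Rabs_mult, (Rabs_pos_eq alpha) by lra.
  assert (Habs : (Rabs eta <= 2 * atan T)%R); [|nra].
  pose proof PI_RGT_0; pose proof (atan_bound T).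
  assert (HaT : (0 <= atan T)%R).
  { destruct HT0 as [HTpos| <-]; [|rewrite atan_0; lra].
    rewrite <- atan_0; apply Rlt_le, atan_increasing, HTpos. }
  apply Rnot_lt_le; intros Hlt.
  assert (cos eta < cos (2 * atan T))%R; [|lra].
  replace (cos eta) with (cos (Rabs eta)).
  2:{ unfold Rabs; destruct (Rcase_abs eta); [apply cos_neg|reflexivity]. }
  apply cos_decreasing_1; lra.
- destruct (Rle_lt_dec 0 x) as [Hx|Hx].
  + apply Rle_trans with 1%R; [lra|]. rewrite <- exp_0; apply exp_le_compat; nra.
  + apply Rle_trans with (exp x); [|apply exp_le_compat; nra].
    pose proof (exp_pos x) as Hp; pose proof (exp_pos (- x)) as Hn.
    assert (Hpn : (exp x * exp (- x) = 1)%R) by (rewrite <- exp_plus, Rplus_opp_r; apply exp_0).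
    assert (H3 : ((1 - t) * exp (- x) <= 4)%R) by nra.
    apply (Rmult_le_compat_l (exp x)) in H3; [|lra]. nra.
Qed.

Lemma sector_first_touch (alpha : R) (p : C -> C) (z1 : C) :
  (0 < alpha <= 1)%R -> (forall z, unit_disc z -> Ccontinuous p z) ->
  unit_disc z1 -> ~ in_sector alpha (p z1) ->
  exists z0, unit_disc z0 /\ ~ in_sector alpha (p z0) /\
    forall z, (Cmod z < Cmod z0)%R -> in_sector alpha (p z).
Proof.
intros Ha Hp Hz1 Hn1; unfold unit_disc in *.
destruct (compact_max (fun z => (Cmod z <= Cmod z1)%R /\ ~ in_sector alpha (p z)) (fun z => - Cmod z)%R
   (Cmod z1) 0) as [z0 [[Hz0 Hn0] Hmax]].
- exists z1; split; [lra|exact Hn1].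
- intros z [Hz _]; exact Hz.
- intros z _; pose proof (Cmod_ge_0 z); lra.
- intros z Hz; destruct (Rle_lt_dec (Cmod z) (Cmod z1)) as [Hle|Hlt].
  + assert (Hin : in_sector alpha (p z)) by (apply NNPP; intros H; apply Hz; split; assumption).
    destruct (in_sector_open alpha p z (Hp z ltac:(lra)) Hin) as [d [Hd Hy]].
    exists d; split; [exact Hd|]; intros y Hyd [_ Hc]; exact (Hc (Hy y Hyd)).
  + exists (Cmod z - Cmod z1)%R; split; [lra|]; intros y Hy [Hc _].
    pose proof (Cmod_triangle_minus z y) as T; rewrite Cmod_minus_sym in T; lra.
- intros z _ eps He; exists eps; split; [exact He|]; intros y _ Hy.
  pose proof (Cmod_triangle_minus z y) as T; rewrite Cmod_minus_sym in T; lra.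
- exists z0; split; [lra|]; split; [exact Hn0|]; intros z Hz.
  apply NNPP; intros Hn; specialize (Hmax z ltac:(split; [lra|exact Hn])); lra.
Qed.

Lemma right_derivative_max (u : R -> R) (l e : R) :
  (0 < e)%R -> (forall x, (0 < x < e)%R -> (u x <= u 0)%R) -> is_derive u 0%R l -> (l <= 0)%R.
Proof.
intros He Hu; rewrite is_derive_RE; intros H.
apply Rnot_lt_le; intros Hl.
destruct (H (l / 2)%R ltac:(lra)) as [d [Hd Hy]].
set (x := (Rmin e d / 2)%R).
assert (Hx : (0 < x /\ x < e /\ x < d)%R).
{ pose proof (Rmin_pos _ _ He Hd); pose proof (Rmin_l e d); pose proof (Rmin_r e d); unfold x; lra. }
specialize (Hu x ltac:(lra)); specialize (Hy x).
rewrite Rminus_0_r, (Rabs_pos_eq x) in Hy by lra; specialize (Hy ltac:(lra)).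
apply Rabs_le_between in Hy; nra.
Qed.

(** The comparison angle [2 alpha atan ((1 - x)^n)] equals [alpha pi / 2] at [x = 0] and has
    derivative [- n alpha] there, since [atan] has slope 1/2 at 1. *)
Lemma is_derive_rotated (alpha s : R) (n : nat) (f g : R -> R) (df dg : R) :
  is_derive f 0%R df -> is_derive g 0%R dg ->
  is_derive (fun x : R => s * f x * cos (2 * alpha * atan ((1 - x) ^ n))
                          - g x * sin (2 * alpha * atan ((1 - x) ^ n)))%R 0%R
    (s * df * cos (alpha * PI / 2) + INR n * alpha * (s * f 0 * sin (alpha * PI / 2))
     - dg * sin (alpha * PI / 2) + INR n * alpha * (g 0 * cos (alpha * PI / 2)))%R.
Proof.
intros Hf Hg.
assert (Hpsi : is_derive (fun x : R => 2 * alpha * atan ((1 - x) ^ n))%R 0%R (- (INR n * alpha))%R).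
{ auto_derive; [trivial|]. rewrite Ropp_0, Rplus_0_r, !pow1; field. }
assert (Hpsi0 : (2 * alpha * atan ((1 - 0) ^ n) = alpha * PI / 2)%R).
{ rewrite Rminus_0_r, pow1, atan_1; field. }
set (psi := fun x : R => (2 * alpha * atan ((1 - x) ^ n))%R) in Hpsi.
change (psi 0%R = (alpha * PI / 2)%R) in Hpsi0.
change (is_derive (fun x : R => s * f x * cos (psi x) - g x * sin (psi x))%R 0%R
    (s * df * cos (alpha * PI / 2) + INR n * alpha * (s * f 0 * sin (alpha * PI / 2))
     - dg * sin (alpha * PI / 2) + INR n * alpha * (g 0 * cos (alpha * PI / 2)))%R).
clearbody psi; rewrite <- Hpsi0.
auto_derive.
- repeat split; eexists; eassumption.
- change (Derive (fun x => f x) 0) with (Derive f 0); change (Derive (fun x => g x) 0) with (Derive g 0).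
  change (Derive (fun x => psi x) 0) with (Derive psi 0).
  rewrite (is_derive_unique f _ _ Hf), (is_derive_unique g _ _ Hg), (is_derive_unique psi _ _ Hpsi); ring.
Qed.

Section FirstTouch.

Variables (alpha : R) (n : nat) (p p1 p2 : C -> C) (z0 : C).
Hypothesis Ha : (0 < alpha <= 1)%R.
Hypothesis Hn : (0 < n)%nat.
Hypothesis Hp1 : forall z, unit_disc z -> is_Cderive p z (p1 z).
Hypothesis Hp2 : forall z, unit_disc z -> is_Cderive p1 z (p2 z).
Hypothesis Hp0 : exists K d : R, (0 < d)%R /\
  forall z, (Cmod z < d)%R -> (Cmod (p z - 1) <= K * Cmod z ^ n)%R.
Hypothesis Hz0 : unit_disc z0.
Hypothesis Hout : ~ in_sector alpha (p z0).
Hypothesis Hin : forall z, (Cmod z < Cmod z0)%R -> in_sector alpha (p z).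

Lemma touch_p_0 : p 0 = 1.
Proof.
destruct Hp0 as [K [d [Hd H]]]; specialize (H 0).
rewrite Cmod_0, pow_i in H by lia; specialize (H Hd).
apply Ceq_minus, Cmod_eq_0; pose proof (Cmod_ge_0 (p 0 - 1)); lra.
Qed.

Lemma touch_radius_pos : (0 < Cmod z0)%R.
Proof.
apply Cmod_gt_0; intros E; apply Hout; rewrite E, touch_p_0; now apply in_sector_1.
Qed.

(** For [w = (V - 1) / (V + 1)] with [V = p^(1/alpha)], the logarithmic derivative is
    [2 V' / (V^2 - 1)] with [V' = p' V / (alpha p)]. It is differentiable wherever [w] is nonzero,
    that is, [V] differs from 1. *)
Lemma touch_schwarz (z : C) : (Cmod z < Cmod z0)%R ->
  (Cmod (sector_to_disc alpha (p z)) <= (Cmod z / Cmod z0) ^ n)%R.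
Proof.
pose proof Hz0 as Hz0'; unfold unit_disc in Hz0'.
assert (Ha0 : RtoC alpha <> 0) by (apply RtoC_neq_0; lra).
assert (Hdisc : forall y, (Cmod y < Cmod z0)%R -> unit_disc y) by (unfold unit_disc; intros; lra).
set (V := fun y => sector_root alpha (p y)).
assert (HV1 : forall y, (Cmod y < Cmod z0)%R -> V y + 1 <> 0).
{ intros y Hy; apply Cplus_1_neq_0, sector_root_Re_pos; auto. }
assert (Hpn : forall y, (Cmod y < Cmod z0)%R -> p y <> 0).
{ intros y Hy; apply Cmod_gt_0, Cmod_gt_0_Re, (in_sector_Re_pos alpha); auto. }
assert (HVd : forall y, (Cmod y < Cmod z0)%R -> is_Cderive V y (p1 y * (V y / (alpha * p y)))).
{ intros y Hy; apply (is_Cderive_comp (sector_root alpha) p); [|auto].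
  apply is_Cderive_sector_root; [tauto|apply (in_sector_Re_pos alpha); auto]. }
assert (Hwd : forall y, (Cmod y < Cmod z0)%R -> is_Cderive (fun x => sector_to_disc alpha (p x)) y
   (p1 y * (2 * V y / (alpha * p y * ((V y + 1) * (V y + 1)))))).
{ intros y Hy; apply (is_Cderive_comp (sector_to_disc alpha) p); [|auto].
  apply is_Cderive_sector_to_disc; auto. }
apply (schwarz_power (fun y => sector_to_disc alpha (p y))
  (fun y => 2 * p1 y * V y / (alpha * p y * (V y * V y - 1)))).
- exact touch_radius_pos.
- intros y Hy; apply Rlt_le, sector_to_disc_lt_1; auto.
- intros y Hy; exact (is_Cderive_continuous _ _ _ (Hwd y Hy)).
- intros y Hy Hw.
  assert (HVm : V y - 1 <> 0).
  { intros E; apply Hw; unfold sector_to_disc; fold (V y); rewrite E; unfold Cdiv; ring. }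
  assert (HVV : V y * V y - 1 <> 0).
  { replace (V y * V y - 1) with ((V y - 1) * (V y + 1)) by ring; apply Cmult_neq_0; auto. }
  split.
  + eapply is_Cderive_eq; [exact (Hwd y Hy)|].
    unfold sector_to_disc; fold (V y).
    field; repeat split; auto.
  + eexists; apply is_Cderive_div.
    * apply Cmult_neq_0; [apply Cmult_neq_0; auto|exact HVV].
    * apply is_Cderive_mult; [apply is_Cderive_mult; [apply is_Cderive_const|auto]|auto].
    * apply is_Cderive_mult.
      -- apply is_Cderive_mult; [apply is_Cderive_const|auto].
      -- apply is_Cderive_minus; [apply is_Cderive_mult; auto|apply is_Cderive_const].
(* Since [sector_to_disc alpha] vanishes at 1 and is Lipschitz near it, [w] inherits from [p - 1]
   the order [n] of vanishing at the origin. *)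
- destruct Hp0 as [K [d [Hd HK]]].
  destruct (is_Cderive_lipschitz _ _ _ (is_Cderive_sector_to_disc alpha 1 Ha (in_sector_1 alpha Ha)))
    as [d1 [Hd1 HL]].
  destruct (is_Cderive_continuous _ _ _ (Hp1 0 ltac:(unfold unit_disc; rewrite Cmod_0; lra)) d1 Hd1)
    as [d2 [Hd2 Hc]].
  rewrite touch_p_0 in Hc; rewrite sector_to_disc_1 in HL by tauto.
  set (L := (_ + 1)%R) in HL.
  assert (HL0 : (0 <= L)%R) by (unfold L; pose proof (Cmod_ge_0 (2 * sector_root alpha 1 / (alpha * 1 * ((sector_root alpha 1 + 1) * (sector_root alpha 1 + 1))))); lra).
  exists (L * K)%R, (Rmin d d2); split; [now apply Rmin_pos|]; intros y Hy.
  assert (Y1 : (Cmod y < d)%R) by (eapply Rlt_le_trans; [exact Hy|apply Rmin_l]).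
  assert (Y2 : (Cmod y < d2)%R) by (eapply Rlt_le_trans; [exact Hy|apply Rmin_r]).
  specialize (Hc y); replace (y - 0) with y in Hc by ring.
  specialize (HL (p y) (Hc Y2)).
  replace (sector_to_disc alpha (p y) - 0) with (sector_to_disc alpha (p y)) in HL by ring.
  specialize (HK y Y1); nra.
Qed.

Lemma touch_radial (t : R) : (0 < t < 1)%R ->
  (Rabs (Im (Clog (p (t * z0)))) <= 2 * alpha * atan (t ^ n))%R /\
  ((1 - t) / 4 <= exp (Re (Clog (p (t * z0)))))%R /\ in_sector alpha (p (t * z0)).
Proof.
intros Ht; pose proof touch_radius_pos as Hr.
assert (Hm : Cmod (t * z0) = (t * Cmod z0)%R) by (rewrite Cmod_mult, Cmod_R, Rabs_pos_eq; lra).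
assert (Hlt : (Cmod (t * z0) < Cmod z0)%R) by (rewrite Hm; nra).
pose proof (touch_schwarz _ Hlt) as HS.
replace (Cmod (t * z0) / Cmod z0)%R with t in HS by (rewrite Hm; field; lra).
pose proof (Hin _ Hlt) as HI.
assert (Htn : (0 <= t ^ n <= t)%R).
{ split; [apply pow_le; lra|]. destruct n as [|k]; [lia|]. simpl.
  assert (t ^ k <= 1)%R by (rewrite <- (pow1 k); apply pow_incr; lra). nra. }
destruct (sector_bounds alpha t (t ^ n) (p (t * z0)) Ha HI) as [H1 H2]; try lra.
auto.
Qed.

(** Radial limit of the sector inequality, valid on the whole circle. The absolute value is first
    replaced by [s * Im] for every [|s| <= 1], so that both sides are differentiable along the
    radius. *)
Lemma touch_closed (z : C) : Cmod z = Cmod z0 ->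
  (cos (alpha * PI / 2) * Rabs (Im (p z)) <= sin (alpha * PI / 2) * Re (p z))%R.
Proof.
intros Hz; pose proof touch_radius_pos as Hr; unfold unit_disc in Hz0.
assert (Hd : is_Cderive (fun x => p ((1 - x) * z)) 0%R (- z * p1 z)).
{ apply (is_Cderive_comp p (fun x => (1 - x) * z)).
  - replace ((1 - 0%R) * z) with z by ring; apply Hp1; unfold unit_disc; lra.
  - eapply is_Cderive_eq.
    + apply is_Cderive_mult; [apply is_Cderive_minus; [apply is_Cderive_const|apply is_Cderive_id]|apply is_Cderive_const].
    + cbv beta; ring. }
set (a := sin (alpha * PI / 2)); set (b := cos (alpha * PI / 2)).
assert (Hb : (0 <= b)%R) by now apply sector_cos_nonneg.
assert (H : forall s : R, (Rabs s <= 1)%R -> (b * (s * Im (p z)) <= a * Re (p z))%R).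
{ intros s Hs.
  pose proof (is_derive_scal _ _ a _ (is_derive_Re_real _ _ _ Hd)) as HR.
  pose proof (is_derive_scal _ _ b _ (is_derive_scal _ _ s _ (is_derive_Im_real _ _ _ Hd))) as HI.
  pose proof (le_right_limit _ _ 1 Rlt_0_1 (ex_intro _ _ HI) (ex_intro _ _ HR)) as HL.
  cbv beta in HL; replace ((1 - 0%R) * z) with z in HL by ring.
  apply HL; intros x Hx.
  assert (Hi : in_sector alpha (p ((1 - x) * z))).
  { apply Hin; rewrite Cmod_mult, <- RtoC_minus, Cmod_R, Rabs_pos_eq, Hz by lra; nra. }
  unfold in_sector in Hi; fold a b in Hi.
  apply Rlt_le; eapply Rle_lt_trans; [|exact Hi].
  apply Rmult_le_compat_l; [exact Hb|].
  eapply Rle_trans; [apply Rle_abs|]; rewrite Rabs_mult.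
  rewrite <- (Rmult_1_l (Rabs (Im (p ((1 - x) * z))))) at 2.
  apply Rmult_le_compat_r; [apply Rabs_pos|exact Hs]. }
unfold Rabs at 1; destruct (Rcase_abs (Im (p z))).
- replace (- Im (p z))%R with (-1 * Im (p z))%R by ring; apply H; rewrite Rabs_left; lra.
- rewrite <- (Rmult_1_l (Im (p z))); apply H; rewrite Rabs_R1; lra.
Qed.

(* [tau] is the rotation, [s] the sign of [Im (p z0)] and [Y = |p z0|]. *)
Lemma touch_conclusion : exists (tau : C) (s sigma Y : R),
  (s * s = 1)%R /\ tau * (z0 * p1 z0) = - sigma /\
  (Re (tau * (z0 * z0 * p2 z0)) <= sigma)%R /\
  tau * p z0 = (0, s * Y)%R /\ (0 <= Y)%R /\ (INR n * alpha * Y <= sigma)%R /\ (0 < sigma)%R.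
Proof.
pose proof touch_radius_pos as Hr; pose proof Hz0 as Hz0'; unfold unit_disc in Hz0'.
set (a := sin (alpha * PI / 2)); set (b := cos (alpha * PI / 2)).
assert (Hapos : (0 < a)%R) by now apply sector_sin_pos.
assert (Hbpos : (0 <= b)%R) by now apply sector_cos_nonneg.
assert (Hs : exists s : R, (s * s = 1)%R /\ Rabs (Im (p z0)) = (s * Im (p z0))%R).
{ unfold Rabs; destruct (Rcase_abs (Im (p z0))); [exists (-1)%R|exists 1%R]; split; ring. }
destruct Hs as [s [Hss Hsa]].
(* The closed inequality holds at [z0] and the strict one fails, so equality holds. *)
assert (Hedge : (a * Re (p z0) = b * (s * Im (p z0)))%R).
{ pose proof (touch_closed z0 eq_refl) as H; fold a b in H; rewrite Hsa in H.
  apply Rle_antisym; [|exact H].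
  apply Rnot_lt_le; intros Hlt; apply Hout; unfold in_sector; fold a b; now rewrite Hsa. }
(* This is [e^(i s (pi / 2 - alpha pi / 2))]: it turns the edge of argument [s alpha pi / 2] to
   argument [s pi / 2] and keeps the sector in the right half-plane. *)
set (tau := ((a, s * b)%R : C)).
assert (HRe : forall q : C, Re (tau * q) = (a * Re q - b * (s * Im q))%R).
{ intros q; unfold tau, Re, Im; simpl; ring. }
assert (HIm : forall q : C, Im (tau * q) = (s * (a * (s * Im q) + b * Re q))%R).
{ intros q; transitivity (a * ((s * s) * Im q) + s * b * Re q)%R; [rewrite Hss|]; unfold tau, Re, Im; simpl; ring. }
assert (Hge : forall z, Cmod z = Cmod z0 -> (0 <= Re (tau * p z)%C)%R).
{ intros z Hz; rewrite HRe; pose proof (touch_closed z Hz) as H; fold a b in H.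
  assert (s * Im (p z) <= Rabs (Im (p z)))%R; [|nra].
  eapply Rle_trans; [apply Rle_abs|]; rewrite Rabs_mult, (Rabs_sqr_1 s Hss); lra. }
set (Y := (a * (s * Im (p z0)) + b * Re (p z0))%R).
assert (Hre0 : (0 <= Re (p z0))%R) by (pose proof (Rabs_pos (Im (p z0))); nra).
assert (Him0 : (0 <= s * Im (p z0))%R) by (rewrite <- Hsa; apply Rabs_pos).
assert (HY : (0 <= Y)%R) by (unfold Y; nra).
(* The circle through [z0] is parametrized by an entire function of [x], so the complex chain rule
   applies before restriction to real [x]. *)
set (zeta := fun x => z0 * Cexp (Ci * x)).
assert (Hzeta : forall x : R, Cmod (zeta x) = Cmod z0).
{ intros x; unfold zeta; rewrite Cmod_mult, Cmod_Cexp.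
  replace (Re (Ci * x)) with 0%R by (simpl; ring); rewrite exp_0; ring. }
assert (Hzeta0 : zeta 0%R = z0).
{ unfold zeta; replace (Ci * 0%R) with (RtoC 0) by ring; rewrite Cexp_0; ring. }
assert (Hdz : forall x, is_Cderive zeta x (Ci * zeta x)).
{ intros x; eapply is_Cderive_eq.
  - apply is_Cderive_mult; [apply is_Cderive_const|].
    apply (is_Cderive_comp Cexp (fun x => Ci * x)); [apply is_Cderive_Cexp|].
    apply is_Cderive_mult; [apply is_Cderive_const|apply is_Cderive_id].
  - cbv beta; unfold zeta; ring. }
set (F := fun x => - (tau * p (zeta x))).
set (F1 := fun x => - (tau * (Ci * (zeta x * p1 (zeta x))))).
assert (HF : forall x : R, is_Cderive F x (F1 x)).
{ intros x; apply (is_Cderive_ext_loc (fun x => - tau * p (zeta x)) _ _ _ 1 Rlt_0_1).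
  { intros y _; unfold F; ring. }
  eapply is_Cderive_eq.
  - apply is_Cderive_mult; [apply is_Cderive_const|].
    apply (is_Cderive_comp p zeta); [apply Hp1; unfold unit_disc; rewrite Hzeta; lra|apply Hdz].
  - cbv beta; unfold F1; ring. }
assert (HF1 : is_Cderive F1 0%R (tau * (z0 * p1 z0 + z0 * z0 * p2 z0))).
{ apply (is_Cderive_ext_loc (fun x => - (tau * Ci) * (zeta x * p1 (zeta x))) _ _ _ 1 Rlt_0_1).
  { intros y _; unfold F1; ring. }
  eapply is_Cderive_eq.
  - apply is_Cderive_mult; [apply is_Cderive_const|].
    apply is_Cderive_mult; [apply Hdz|].
    apply (is_Cderive_comp p1 zeta); [apply Hp2; unfold unit_disc; rewrite Hzeta; lra|apply Hdz].
  - cbv beta; rewrite Hzeta0.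
    transitivity (- (Ci * Ci) * (tau * (z0 * p1 z0 + z0 * z0 * p2 z0))); [ring|].
    replace (Ci * Ci) with (- (1)) by (unfold Ci, Cmult, Copp, RtoC; simpl; f_equal; ring).
    ring. }
assert (Hle : forall x : R, (Rabs x < 1)%R -> (Re (F x) <= Re (F 0%R))%R).
{ intros x _; unfold F; rewrite Hzeta0.
  change (Re (- (tau * p (zeta x)))) with (- Re (tau * p (zeta x))%C)%R.
  change (Re (- (tau * p z0))) with (- Re (tau * p z0)%C)%R.
  pose proof (Hge _ (Hzeta x)); rewrite (HRe (p z0)); lra. }
pose proof (second_derivative_local_max (fun x : R => Re (F x)) (fun x : R => Re (F1 x)) _ 1 Rlt_0_1
  (fun x _ => is_derive_Re_real _ _ _ (HF x)) Hle (is_derive_Re_real _ _ _ HF1)) as Hsecond.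
pose proof (derivative_local_max (fun x : R => Re (F x)) _ 1 Rlt_0_1 Hle
  (is_derive_Re_real _ _ _ (HF 0%R))) as Hfirst.
unfold F1 in Hfirst; rewrite Hzeta0 in Hfirst.
set (q := z0 * p1 z0) in *.
(* The derivative of [Re F] at 0 is [Re (- i tau q) = Im (tau q)], which vanishes at the maximum. *)
assert (Himq : Im (tau * q) = 0%R).
{ revert Hfirst; unfold Ci, Re, Im; simpl; lra. }
set (sigma := (- Re (tau * q)%C)%R).
assert (Hq : tau * q = - sigma).
{ rewrite (surjective_pairing (tau * q)); change (fst (tau * q)) with (Re (tau * q)); change (snd (tau * q)) with (Im (tau * q)).
  rewrite Himq; unfold sigma, RtoC, Copp; simpl; f_equal; ring. }
assert (Hrad : is_Cderive (fun x => p ((1 - x) * z0)) 0%R (- q)).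
{ eapply is_Cderive_eq.
  - apply (is_Cderive_comp p (fun x => (1 - x) * z0)).
    + replace ((1 - 0%R) * z0) with z0 by ring; now apply Hp1.
    + apply is_Cderive_mult; [apply is_Cderive_minus; [apply is_Cderive_const|apply is_Cderive_id]|apply is_Cderive_const].
  - unfold q; cbv beta; ring. }
(* Along the radius [u = |p| sin (s arg p - psi)], where [psi] bounds [|arg p|]. Hence [u <= 0] with
   equality at [x = 0], and its derivative there, [n alpha Y - sigma], is at most 0. *)
assert (HsY : (INR n * alpha * Y <= sigma)%R).
{ set (u := fun x : R => (s * Im (p ((1 - x)%R * z0)) * cos (2 * alpha * atan ((1 - x) ^ n))
                            - Re (p ((1 - x)%R * z0)) * sin (2 * alpha * atan ((1 - x) ^ n)))%R).
  assert (Hu : is_derive u 0%R (INR n * alpha * Y - sigma)%R).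
  { assert (HR : is_derive (fun x : R => Re (p ((1 - x)%R * z0))) 0%R (- Re q)%R).
    { apply (is_derive_ext (fun x : R => Re (p ((1 - x) * z0)))); [intros x; now rewrite RtoC_minus|].
      exact (is_derive_Re_real _ _ _ Hrad). }
    assert (HI : is_derive (fun x : R => Im (p ((1 - x)%R * z0))) 0%R (- Im q)%R).
    { apply (is_derive_ext (fun x : R => Im (p ((1 - x) * z0)))); [intros x; now rewrite RtoC_minus|].
      exact (is_derive_Im_real _ _ _ Hrad). }
    refine (eq_ind _ (fun l => is_derive u 0%R l)
      (is_derive_rotated alpha s n (fun x : R => Im (p ((1 - x)%R * z0)))
         (fun x : R => Re (p ((1 - x)%R * z0))) _ _ HI HR) _ _).
    fold a b; replace ((1 - 0)%R * z0) with z0 by (rewrite Rminus_0_r; ring).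
    unfold sigma, Y; rewrite HRe; match goal with |- ?x = ?y => change (@eq R x y) end; ring. }
  assert (Hu0 : u 0%R = 0%R).
  { unfold u; replace ((1 - 0)%R * z0) with z0 by (rewrite Rminus_0_r; ring).
    rewrite Rminus_0_r, pow1, atan_1.
    replace (2 * alpha * (PI / 4))%R with (alpha * PI / 2)%R by field.
    fold a b; lra. }
  assert (H : (INR n * alpha * Y - sigma <= 0)%R); [|lra].
  apply (right_derivative_max u _ 1 Rlt_0_1); [|exact Hu].
  intros x Hx; rewrite Hu0.
  destruct (touch_radial (1 - x) ltac:(lra)) as [Harg [_ Hi]].
  destruct (Clog_polar _ (in_sector_Re_pos alpha _ Ha Hi)) as [E1 E2].
  unfold u; rewrite E1, E2.
  set (e := exp _); set (th := Im (Clog _)) in *; set (psi := (2 * alpha * atan ((1 - x) ^ n))%R) in *.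
  assert (He : (0 < e)%R) by apply exp_pos.
  assert (Hpsi : (psi <= PI / 2)%R).
  { assert (atan ((1 - x) ^ n) <= PI / 4)%R.
    { rewrite <- atan_1.
      assert (H1 : ((1 - x) ^ n <= 1)%R) by (apply Rle_trans with (1 ^ n)%R; [apply pow_incr; lra|rewrite pow1; lra]).
      destruct H1 as [H1| ->]; [apply Rlt_le, atan_increasing, H1|apply Rle_refl]. }
    assert (0 <= atan ((1 - x) ^ n))%R.
    { rewrite <- atan_0; apply Rlt_le, atan_increasing, pow_lt; lra. }
    unfold psi; nra. }
  assert (Hsin : (s * sin th = sin (s * th))%R).
  { destruct (Rmult_integral (s - 1) (s + 1) ltac:(nra)) as [Es|Es].
    - replace s with 1%R by lra; rewrite !Rmult_1_l; reflexivity.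
    - replace s with (-1)%R by lra; replace (-1 * th)%R with (- th)%R by ring; rewrite sin_neg; ring. }
  assert (Hcos : (cos th = cos (s * th))%R).
  { destruct (Rmult_integral (s - 1) (s + 1) ltac:(nra)) as [Es|Es].
    - replace s with 1%R by lra; rewrite !Rmult_1_l; reflexivity.
    - replace s with (-1)%R by lra; replace (-1 * th)%R with (- th)%R by ring; rewrite cos_neg; ring. }
  replace (s * (e * sin th) * cos psi - e * cos th * sin psi)%R
    with (e * (s * sin th * cos psi - cos th * sin psi))%R by ring.
  rewrite Hsin, Hcos, <- sin_minus.
  assert (Hst : (Rabs (s * th) <= psi)%R).
  { rewrite Rabs_mult, (Rabs_sqr_1 s Hss); lra. }
  apply Rabs_le_between in Hst.
  assert (0 <= sin (psi - s * th))%R by (pose proof PI_RGT_0; apply sin_ge_0; lra).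
  replace (s * th - psi)%R with (- (psi - s * th))%R by ring; rewrite sin_neg; nra. }
exists tau, s, sigma, Y.
split; [exact Hss|]; split; [exact Hq|]; split.
{ replace (tau * (q + z0 * z0 * p2 z0)) with (tau * q + tau * (z0 * z0 * p2 z0)) in Hsecond by ring.
  unfold sigma; unfold Re in *; simpl in *; lra. }
split.
{ rewrite (surjective_pairing (tau * p z0)).
  change (fst (tau * p z0)) with (Re (tau * p z0)); change (snd (tau * p z0)) with (Im (tau * p z0)).
  rewrite HRe, HIm; unfold Y; f_equal; lra. }
split; [exact HY|]; split; [exact HsY|].
assert (Hna : (0 < INR n * alpha)%R) by (apply Rmult_lt_0_compat; [apply lt_0_INR; lia|lra]).
(* If [Y = 0], the contact is at the vertex. Were [sigma] also 0, [p ((1 - x) z0)] would be [o(x)],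
   whereas the radial estimate keeps its modulus at least [x / 4]; the tolerance 1/8 is any value
   below 1/4. *)
destruct HY as [HY|HY]; [nra|].
assert (Hp00 : p z0 = 0).
{ assert (H1 : (s * Im (p z0) = 0)%R) by (unfold Y in HY; nra).
  assert (Re (p z0) = 0)%R by nra.
  assert (Im (p z0) = 0)%R.
  { transitivity (s * (s * Im (p z0)))%R; [rewrite <- Rmult_assoc, Hss|rewrite H1]; ring. }
  apply injective_projections; assumption. }
assert (Hs0 : (0 <= sigma)%R) by (rewrite <- HY in HsY; lra).
destruct Hs0 as [Hs0|Hs0]; [exact Hs0|exfalso].
assert (Hq0 : q = 0).
{ rewrite <- Hs0 in Hq.
  assert (Ht0 : tau <> 0) by (intros E; pose proof (f_equal Re E) as E'; simpl in E'; lra).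
  replace q with (/ tau * (tau * q)) by (field; exact Ht0).
  rewrite Hq; ring. }
rewrite Hq0 in Hrad; rewrite is_CderiveE in Hrad.
destruct (Hrad (/ 8)%R ltac:(lra)) as [d [Hd H]].
set (x := (Rmin d 1 / 2)%R).
assert (Hx : (0 < x < d /\ x < 1)%R).
{ pose proof (Rmin_pos d 1 Hd Rlt_0_1); pose proof (Rmin_l d 1); pose proof (Rmin_r d 1); unfold x; lra. }
specialize (H (RtoC x)); rewrite <- RtoC_minus, Cmod_R, Rminus_0_r, Rabs_pos_eq in H by lra.
specialize (H ltac:(lra)).
replace ((1 - 0%R) * z0) with z0 in H by ring.
rewrite Hp00 in H; rewrite <- RtoC_minus in H.
replace (p ((1 - x)%R * z0) - 0 - x * - 0) with (p ((1 - x)%R * z0)) in H by ring.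
destruct (touch_radial (1 - x) ltac:(lra)) as [_ [Hlow Hi]].
assert (Hcm : Cmod (p ((1 - x)%R * z0)) = exp (Re (Clog (p ((1 - x)%R * z0))))).
{ rewrite <- (Cexp_Clog (p ((1 - x)%R * z0))) at 1 by now apply (in_sector_Re_pos alpha).
  apply Cmod_Cexp. }
rewrite Hcm in H; lra.
Qed.

End FirstTouch.

Lemma in_sector_of_ode (n : nat) (alpha c : R) (D E p p1 p2 : C -> C) :
  (0 < n)%nat -> (0 < alpha <= 1)%R -> (0 <= c)%R ->
  (forall z, unit_disc z -> (Rabs (Im (E z)) < INR n * alpha * (Re (D z) - c))%R) ->
  (forall z, unit_disc z -> is_Cderive p z (p1 z)) ->
  (forall z, unit_disc z -> is_Cderive p1 z (p2 z)) ->
  (exists K d : R, (0 < d)%R /\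
     forall z, (Cmod z < d)%R -> (Cmod (p z - 1) <= K * Cmod z ^ n)%R) ->
  (forall z, unit_disc z -> z <> 0 ->
     c * (z * z * p2 z) + D z * (z * p1 z) + E z * p z = 0) ->
  forall z, unit_disc z -> in_sector alpha (p z).
Proof.
intros Hn Ha Hc HDE Hp1 Hp2 Hp0 Hode z1 Hz1; apply NNPP; intros Hn1.
destruct (sector_first_touch alpha p z1 Ha
  (fun z Hz => is_Cderive_continuous _ _ _ (Hp1 z Hz)) Hz1 Hn1) as [z0 [Hz0 [Hout Hin]]].
destruct (touch_conclusion alpha n p p1 p2 z0 Ha Hn Hp1 Hp2 Hp0 Hz0 Hout Hin)
  as [tau [s [sigma [Y [Hss [Hq [Hq2 [HpY [HY [HsY Hs]]]]]]]]]].
assert (Hz00 : z0 <> 0).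
{ apply Cmod_gt_0, (touch_radius_pos alpha n p z0); assumption. }
specialize (Hode z0 Hz0 Hz00); specialize (HDE z0 Hz0).
assert (Hna : (0 < INR n * alpha)%R) by (apply Rmult_lt_0_compat; [apply lt_0_INR; lia|lra]).
pose proof (Rabs_pos (Im (E z0))) as HE0.
assert (HDc : (0 < Re (D z0) - c)%R) by nra.
(* After multiplication by [tau] the first-derivative factor is real and the factor of [E] is
   imaginary, so the real part involves only [Re D] and [Im E]. *)
assert (Hmain : c * (tau * (z0 * z0 * p2 z0)) + D z0 * - sigma + E z0 * (0, s * Y)%R = 0).
{ rewrite <- Hq, <- HpY.
  transitivity (tau * (c * (z0 * z0 * p2 z0) + D z0 * (z0 * p1 z0) + E z0 * p z0)); [ring|].
  rewrite Hode; ring. }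
apply (f_equal Re) in Hmain.
set (X := tau * (z0 * z0 * p2 z0)) in *; clearbody X.
assert (HRe : (c * Re X - sigma * Re (D z0) - s * Y * Im (E z0) = 0)%R).
{ revert Hmain; unfold Re, Im; simpl; lra. }
assert (HcX : (c * Re X <= c * sigma)%R) by (apply Rmult_le_compat_l; assumption).
assert (HsE : (- (s * Im (E z0)) <= Rabs (Im (E z0)))%R).
{ eapply Rle_trans; [apply Rle_abs|]; rewrite Rabs_Ropp, Rabs_mult, (Rabs_sqr_1 s Hss); lra. }
assert (H1 : (sigma * (Re (D z0) - c) <= Y * Rabs (Im (E z0)))%R) by nra.
assert (H2 : (INR n * alpha * Y * (Re (D z0) - c) <= sigma * (Re (D z0) - c))%R)
  by (apply Rmult_le_compat_r; lra).
(* For [Y > 0] the strict hypothesis at [z0], multiplied by [Y], contradicts [H1] and [H2]. For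
   [Y = 0], [H1] contradicts [sigma > 0]. *)
destruct HY as [HY|HY]; [nra|subst Y; nra].
Qed.

(** * From [h] to its logarithmic derivative, and the subordination *)

Lemma C_lim_eq (f : C -> C) (z l : C) :
  (forall eps : R, (0 < eps)%R -> exists delta : R, (0 < delta)%R /\
    forall y, y <> z -> (Cmod (y - z) < delta)%R -> (Cmod (f y - l) < eps)%R) ->
  C_lim f z = l.
Proof.
intros H; apply is_C_lim_unique; intros P [eps HP].
destruct (H eps (cond_pos eps)) as [d [Hd Hy]].
assert (Hd' : (0 < d / sqrt 2)%R) by (apply Rdiv_lt_0_compat; [exact Hd|apply sqrt_lt_R0; lra]).
exists (mkposreal _ Hd'); intros y Hb Hyz; apply HP.
apply C_NormedModule_mixin_compat1, Hy; [exact Hyz|].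
replace d with (sqrt 2 * (d / sqrt 2))%R.
- exact (C_NormedModule_mixin_compat2 z y (mkposreal _ Hd') Hb).
- field; apply Rgt_not_eq, sqrt_lt_R0; lra.
Qed.

Lemma converges_on_disc_0 (a : nat -> C) (g : C -> C) : converges_on_disc a g -> g 0 = a 0%nat.
Proof.
intros Ha; specialize (Ha 0 ltac:(unfold unit_disc; rewrite Cmod_0; lra)).
apply is_pseries_Cseries in Ha.
exact (filterlim_locally_unique (V := C_NormedModule) _ _ _ Ha (is_pseries_0 (V := C_NormedModule) a)).
Qed.

Lemma is_Cderive_ext_disc (f g : C -> C) (z l : C) :
  (forall y, unit_disc y -> f y = g y) -> unit_disc z -> is_Cderive f z l -> is_Cderive g z l.
Proof.
intros Hfg Hz; unfold unit_disc in *.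
apply (is_Cderive_ext_loc f g z l (1 - Cmod z)); [lra|]; intros y Hy; apply Hfg.
pose proof (Cmod_triangle_minus y z); lra.
Qed.

Lemma C_derive_disc (f g g1 : C -> C) :
  (forall y, unit_disc y -> f y = g y) -> (forall y, unit_disc y -> is_Cderive g y (g1 y)) ->
  forall z, unit_disc z -> C_derive f z = g1 z.
Proof.
intros Hfg Hg z Hz; apply is_C_derive_unique.
apply (is_Cderive_ext_disc g f); [intros y Hy; symmetry; now apply Hfg|exact Hz|now apply Hg].
Qed.

Theorem corollary2p11 (n : nat) (alpha c : R) (D E h : C -> C)
  (hn : (0 < n)%nat)
  (halpha : (0 < alpha <= 1)%R)
  (hc : (0 <= c)%R)
  (hDE : forall z, unit_disc z ->
     (Rabs (Im (E z)) < INR n * alpha * (Re (D z) - c))%R)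
  (hA : class_A n h)
  (h_quot : zero_free_off_0 h)
  (h_eq : let h1 := C_derive h in
          let h2 := C_derive h1 in
          let h3 := C_derive h2 in
          forall z, unit_disc z ->
     c * (2 * cont0 (fun t => t * h1 t / h t) z ^ 3
          - cont0 (fun t => 3 * t ^ 3 * h1 t * h2 t / h t ^ 2) z
          + cont0 (fun t => t ^ 3 * h3 t / h t) z)
     + (2 * c + D z)
       * (cont0 (fun t => t ^ 2 * h2 t / h t) z
          - cont0 (fun t => t * h1 t / h t) z ^ 2)
     + (D z + E z) * cont0 (fun t => t * h1 t / h t) z = 0) :
  strongly_starlike alpha h.
Proof.
pose proof hA as hA'.
destruct hA' as [g [[Hg [a [Ha0 [Han Has]]]] Hh]].
assert (Ha : converges_on_disc a g).
{ intros z Hz; apply is_pseries_Cseries, Has, Hz. }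
destruct (converges_on_disc_derive a g Ha) as [g1 [Ha1 Hg1]].
destruct (converges_on_disc_derive _ g1 Ha1) as [g2 [Ha2 Hg2]].
destruct (converges_on_disc_derive _ g2 Ha2) as [g3 [_ Hg3]].
assert (Hdisc0 : unit_disc 0) by (unfold unit_disc; rewrite Cmod_0; lra).
assert (Hg0 : g 0 = 1) by (rewrite (converges_on_disc_0 a g Ha); exact Ha0).
assert (Hgnz : forall z, unit_disc z -> g z <> 0).
{ intros z Hz; destruct (Ceq_dec z 0) as [->|Hz0].
  - rewrite Hg0; apply RtoC_neq_0; lra.
  - intros E0; apply (h_quot z Hz Hz0); rewrite (Hh z Hz), E0; ring. }
assert (Hd1 : forall z, unit_disc z -> C_derive h z = g z + z * g1 z).
{ apply (C_derive_disc h (fun z => z * g z)); [exact Hh|]; intros y Hy.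
  eapply is_Cderive_eq; [apply is_Cderive_mult; [apply is_Cderive_id|now apply Hg1]|cbv beta; ring]. }
assert (Hd2 : forall z, unit_disc z -> C_derive (C_derive h) z = 2 * g1 z + z * g2 z).
{ apply (C_derive_disc _ (fun z => g z + z * g1 z)); [exact Hd1|]; intros y Hy.
  eapply is_Cderive_eq; [apply is_Cderive_plus; [now apply Hg1|apply is_Cderive_mult; [apply is_Cderive_id|now apply Hg2]]|cbv beta; ring]. }
assert (Hd3 : forall z, unit_disc z -> C_derive (C_derive (C_derive h)) z = 3 * g2 z + z * g3 z).
{ apply (C_derive_disc _ (fun z => 2 * g1 z + z * g2 z)); [exact Hd2|]; intros y Hy.
  eapply is_Cderive_eq; [apply is_Cderive_plus; apply is_Cderive_mult;
    [apply is_Cderive_const|now apply Hg2|apply is_Cderive_id|now apply Hg3]|cbv beta; ring]. }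
(* Written through [h = z g], the quotient [z h' / h] becomes [1 + z g' / g], which is defined and
   differentiable at 0 as well; [p1] and [p2] are its derivatives. *)
set (p := fun z => 1 + z * g1 z / g z).
set (p1 := fun z => (g1 z + z * g2 z) / g z - z * g1 z * g1 z / (g z * g z)).
set (p2 := fun z => (2 * g2 z + z * g3 z) / g z - (g1 z + z * g2 z) * g1 z / (g z * g z)
   - ((g1 z * g1 z + 2 * z * g1 z * g2 z) / (g z * g z) - 2 * z * g1 z * g1 z * g1 z / (g z * g z * g z))).
assert (Hp1 : forall z, unit_disc z -> is_Cderive p z (p1 z)).
{ intros z Hz; pose proof (Hgnz z Hz) as Hgz; eapply is_Cderive_eq.
  - apply is_Cderive_plus; [apply is_Cderive_const|].
    apply is_Cderive_div; [exact Hgz|apply is_Cderive_mult; [apply is_Cderive_id|now apply Hg2]|now apply Hg1].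
  - unfold p1; cbv beta; field; exact Hgz. }
assert (Hp2 : forall z, unit_disc z -> is_Cderive p1 z (p2 z)).
{ intros z Hz; pose proof (Hgnz z Hz) as Hgz; eapply is_Cderive_eq.
  - apply is_Cderive_minus; apply is_Cderive_div.
    + exact Hgz.
    + apply is_Cderive_plus; [now apply Hg2|apply is_Cderive_mult; [apply is_Cderive_id|now apply Hg3]].
    + now apply Hg1.
    + now apply Cmult_neq_0.
    + apply is_Cderive_mult; [apply is_Cderive_mult; [apply is_Cderive_id|now apply Hg2]|now apply Hg2].
    + apply is_Cderive_mult; now apply Hg1.
  - unfold p2; cbv beta; field; exact Hgz. }
assert (Hp0 : exists K d : R, (0 < d)%R /\
  forall z, (Cmod z < d)%R -> (Cmod (p z - 1) <= K * Cmod z ^ n)%R).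
{ destruct (derive_coef_vanishing_bound a g g1 n hn Ha Ha1 Han) as [K HK].
  destruct (is_Cderive_continuous _ _ _ (Hg1 0 Hdisc0) (/ 2)%R ltac:(lra)) as [d [Hd Hy]].
  exists (2 * K)%R, (Rmin d (/ 2)); split; [apply Rmin_pos; lra|]; intros z Hz.
  assert (Z1 : (Cmod z < d)%R) by (eapply Rlt_le_trans; [exact Hz|apply Rmin_l]).
  assert (Z2 : (Cmod z < / 2)%R) by (eapply Rlt_le_trans; [exact Hz|apply Rmin_r]).
  specialize (Hy z); replace (z - 0) with z in Hy by ring; specialize (Hy Z1); rewrite Hg0 in Hy.
  specialize (HK z (Rlt_le _ _ Z2)).
  (* Near 0 the denominator [g] exceeds 1/2 in modulus, whence the constant [2 * K]. *)
  assert (Hgz : (/ 2 < Cmod (g z))%R).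
  { pose proof (Cmod_triangle_minus 1 (g z)) as T; rewrite Cmod_1, Cmod_minus_sym in T; lra. }
  assert (Hgz0 : g z <> 0) by (apply Cmod_gt_0; lra).
  replace (p z - 1) with (z * g1 z / g z) by (unfold p; ring).
  rewrite Cmod_div by exact Hgz0; apply Rle_div_l; [lra|].
  pose proof (Cmod_ge_0 (z * g1 z)); nra. }
(* Off 0 the identities are [z p' = p + z^2 h'' / h - p^2] and [z^2 p'' = 2 p^3 - 3 z^3 h' h'' / h^2
   + z^3 h''' / h + 2 (z^2 h'' / h - p^2)]; they collapse the hypothesis to a linear equation in
   [p]. *)
assert (Hode : forall z, unit_disc z -> z <> 0 ->
  c * (z * z * p2 z) + D z * (z * p1 z) + E z * p z = 0).
{ intros z Hz Hz0; specialize (h_eq z Hz); cbv zeta in h_eq; unfold cont0 in h_eq.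
  destruct (Ceq_dec z 0) as [Ez|_]; [contradiction|].
  rewrite (Hd3 z Hz), (Hd2 z Hz), (Hd1 z Hz), (Hh z Hz) in h_eq.
  rewrite <- h_eq; unfold p, p1, p2; pose proof (Hgnz z Hz); field; auto. }
pose proof (in_sector_of_ode n alpha c D E p p1 p2 hn halpha hc hDE Hp1 Hp2 Hp0 Hode) as Hsec.
assert (Hquot : forall z, unit_disc z -> z <> 0 -> z * C_derive h z / h z = p z).
{ intros z Hz Hz0; rewrite (Hd1 z Hz), (Hh z Hz); unfold p; pose proof (Hgnz z Hz); field; auto. }
split; [|split; [exact h_quot|]].
- exists g; split; [|exact Hh]; split; [exact Hg|].
  exists a; split; [exact Ha0|]; split; [intros k Hk; lia|exact Has].
- exists (fun z => sector_to_disc alpha (p z)); split; [|split; [|split]].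
  + intros z Hz; eexists; apply (is_Cderive_comp (sector_to_disc alpha) p); [|now apply Hp1].
    apply is_Cderive_sector_to_disc; [exact halpha|now apply Hsec].
  + intros z Hz; apply sector_to_disc_lt_1; [exact halpha|now apply Hsec].
  + replace (p 0) with (RtoC 1); [apply sector_to_disc_1; tauto|].
    unfold p; rewrite Hg0; field; apply RtoC_neq_0; lra.
  + intros z Hz; rewrite Cpower_sector_to_disc; [|exact halpha|now apply Hsec].
    (* At the origin the quotient is a punctured limit, identified with [p 0] by continuity of
       [p]. *)
    unfold cont0; destruct (Ceq_dec z 0) as [->|Hz0]; [|now apply Hquot].
    apply C_lim_eq; intros eps He.
    destruct (is_Cderive_continuous _ _ _ (Hp1 0 Hdisc0) eps He) as [d [Hd Hy]].
    exists (Rmin d 1); split; [apply Rmin_pos; lra|]; intros y Hy0 Hyd.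
    rewrite Hquot; [apply Hy; eapply Rlt_le_trans; [exact Hyd|apply Rmin_l]| |exact Hy0].
    unfold unit_disc; replace y with (y - 0) by ring.
    eapply Rlt_le_trans; [exact Hyd|apply Rmin_r].
Qed.
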